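(* Let $\Omega\subset\mathbb{R}^n$ be a domain with boundary of class $C^2$ satisfying a uniform interior sphere condition. If $s\ge1$ then $\mathcal{B}_1(\Omega)\ge(n-1)\underline{\mathcal{H}}$, where $\underline{\mathcal{H}}:=\inf_{y\in\partial\Omega}\mathcal{H}(y)$.
   Context: $d(x):=\operatorname{dist}(x,\mathbb{R}^n\setminus\Omega)$. $\Omega$ satisfies a uniform interior sphere condition if there is $r>0$ such that for every $y\in\partial\Omega$ there is an open ball of radius $r$ contained in $\Omega$ whose boundary contains $y$. $\mathcal{H}(y):=\frac1{n-1}\sum_{i=1}^{n-1}\kappa_i(y)$ is the mean curvature, $\kappa_i$ the principal curvatures of $\partial\Omega$, with the convention that the sphere bounding a ball of radius $R$ has all $\kappa_i=1/R$. For $s\ge1$, $\mathcal{B}_1(\Omega):=\inf\Big\{\frac{\int_\Omega |\nabla u|d^{1-s}dx-(s-1)\int_\Omega|u|d^{-s}dx}{\int_\Omega|u|d^{1-s}dx}: u\in C_c^\infty(\Omega)\setminus\{0\}\Big\}$. *)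

(* Defs.v *)
From HB Require Import structures.
From mathcomp Require Import all_boot all_order all_algebra.
From mathcomp Require Import all_classical all_reals all_analysis.
Set Implicit Arguments. Unset Strict Implicit. Unset Printing Implicit Defensive.
Import Order.TTheory GRing.Theory Num.Theory.
Import numFieldNormedType.Exports.
Local Open Scope classical_set_scope.
Local Open Scope ring_scope.

Section Defs.
Variable R : realType.

Definition enorm (n : nat) (v : 'rV[R]_n) : R := Num.sqrt (\sum_i (v 0 i) ^+ 2).

Definition eball (n : nat) (c : 'rV[R]_n) (r : R) : set 'rV[R]_n :=
  [set x | enorm (x - c) < r].

Definition dist_compl (n : nat) (Om : set 'rV[R]_n) (x : 'rV[R]_n) : R :=
  inf [set enorm (x - z) | z in ~` Om].

Definition partial (n : nat) (i : 'I_n) (f : 'rV[R]_n -> R) : 'rV[R]_n -> R :=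
  fun x => derive f x (delta_mx 0 i).

Definition grad_norm (n : nat) (f : 'rV[R]_n -> R) (x : 'rV[R]_n) : R :=
  Num.sqrt (\sum_i (partial i f x) ^+ 2).

Fixpoint Ck (n k : nat) : ('rV[R]_n -> R) -> Prop :=
  match k with
  | 0 => fun f => continuous f
  | k'.+1 => fun f => (forall x, differentiable f x) /\ forall i, Ck k' (partial i f)
  end.

Definition Cinf (n : nat) (f : 'rV[R]_n -> R) : Prop := forall k, Ck k f.

Definition test_fun (n : nat) (Om : set 'rV[R]_n) (u : 'rV[R]_n -> R) : Prop :=
  [/\ Cinf u, compact (closure [set x | u x != 0]),
      closure [set x | u x != 0] `<=` Om & exists x, u x != 0].

(* Lebesgue integral over R^n of an extended-real valued function, as the
   iterated one-dimensional Lebesgue integral (Tonelli; used only for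
   nonnegative integrands). *)
Fixpoint iint (n : nat) : ('rV[R]_n -> \bar R) -> \bar R :=
  match n return ('rV[R]_n -> \bar R) -> \bar R with
  | 0 => fun f => f 0
  | k.+1 => fun f =>
      (\int[lebesgue_measure]_(x in [set: R])
         iint (fun v : 'rV[R]_k => f (row_mx (const_mx x : 'rV[R]_1) v)))%E
  end.

Definition integral_on (n : nat) (Om : set 'rV[R]_n) (f : 'rV[R]_n -> R) : \bar R :=
  iint (fun x => (\1_Om x * f x)%:E).

Definition B1_quotient (n : nat) (Om : set 'rV[R]_n) (s : R) (u : 'rV[R]_n -> R) : R :=
  let d := dist_compl Om in
  (fine (integral_on Om (fun x => grad_norm u x * d x `^ (1 - s)))
   - (s - 1) * fine (integral_on Om (fun x => `|u x| * d x `^ (- s))))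
  / fine (integral_on Om (fun x => `|u x| * d x `^ (1 - s))).

Definition B1 (n : nat) (Om : set 'rV[R]_n) (s : R) : \bar R :=
  ereal_inf [set (B1_quotient Om s u)%:E | u in test_fun Om].

Definition bdry (n : nat) (Om : set 'rV[R]_n) : set 'rV[R]_n := closure Om `\` Om.

Definition join (n : nat) (x' : 'rV[R]_n.-1) (t : R) : 'rV[R]_n :=
  \row_(i < n) oapp (fun j : 'I_n.-1 => x' 0 j) t (insub (val i)).

(* (Q, rho, g) is a C^2 chart of bdry Omega at y: after the rigid motion
   z |-> y + z Q (Q orthogonal), Omega near y is the supergraph
   {t > g(x')} of a C^2 function g with g(0) = 0, grad g(0) = 0. *)
Definition bdry_chart (n : nat) (Om : set 'rV[R]_n) (y : 'rV[R]_n)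
    (Q : 'M[R]_n) (rho : R) (g : 'rV[R]_n.-1 -> R) : Prop :=
  [/\ Q *m Q^T = 1%:M, 0 < rho, Ck 2 g,
      g 0 = 0 /\ (forall j, partial j g 0 = 0) &
      forall x' t, enorm (join x' t) < rho ->
        (Om (y + join x' t *m Q) <-> g x' < t)].

Definition C2_boundary (n : nat) (Om : set 'rV[R]_n) : Prop :=
  forall y, bdry Om y -> exists Q rho g, bdry_chart Om y Q rho g.

Definition interior_sphere (n : nat) (Om : set 'rV[R]_n) : Prop :=
  exists2 r : R, 0 < r & forall y, bdry Om y ->
    exists c, eball c r `<=` Om /\ enorm (y - c) = r.

(* Mean curvature computed in a chart: the principal curvatures kappa_i are
   the eigenvalues of the Hessian D^2 g(0) of the local graph function (with
   the inner side above the graph, so that a sphere of radius R bounding a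
   ball has kappa_i = 1/R); their mean is trace(D^2 g(0)) / (n-1). *)
Definition mean_curv_chart (n : nat) (g : 'rV[R]_n.-1 -> R) : R :=
  (\sum_j partial j (partial j g) 0) / (n.-1)%:R.

(* underline H = inf_{y in bdry Omega} H(y); H(y) does not depend on the
   chart, so we take the infimum over all boundary points and all charts. *)
Definition Hinf (n : nat) (Om : set 'rV[R]_n) : \bar R :=
  ereal_inf [set (mean_curv_chart g)%:E | g in
     [set g | exists y Q rho, bdry Om y /\ bdry_chart Om y Q rho g]].

End Defs.

(* Main.v *)
Require Import Defs.
From HB Require Import structures.
From mathcomp Require Import all_boot all_order all_algebra.
From mathcomp Require Import all_classical all_reals all_analysis.
From mathcomp Require Import measurable_realfun ftc ring lra.
Import Order.TTheory GRing.Theory Num.Theory.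
Import numFieldNormedType.Exports.
Local Open Scope classical_set_scope.
Local Open Scope ring_scope.
Set Implicit Arguments. Unset Strict Implicit. Unset Printing Implicit Defensive.

(** No differentiability of the distance function [d] is used, only difference
    quotients.  If [y] is a boundary point nearest to [x], then
    [d (x + v) <= |x + v - y|], so forward quotients of [d] at [x] are at most,
    and backward ones at least, the components of the unit normal
    [(x - y) / |x - y|], up to O(h).  A summation by parts shows that forward and
    backward quotients agree in the limit in L^1, which replaces [|grad d| = 1]
    almost everywhere.  In a chart at [y], comparing instead with the graph point
    [(v', g v')] vertically below [x + v] gives
    [d (x + v) <= d x + v_n - g v'], so the discrete Laplacian of [d] at [x] has
    limsup at most [- tr D^2 g(0)], i.e. minus [n - 1] times the mean curvature.
    Testing this with
    [|u| d^(1-s)], summing by parts discretely and letting the step tend to 0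
    yields the inequality.  All limits are dominated convergence for continuous
    functions supported in a fixed cube, which holds for the iterated integral by
    induction on the dimension. *)

(** * Integrals of compactly supported functions on the line *)

(** The unit normal [nu] at [x] depends on a choice of nearest boundary point and need not be
    measurable in [x], so it never enters an integral. With [c = h / (2 de)] one has [Dp <= nu + c]
    and [nu - c <= Dm] in each coordinate, so [Dp - nu] is controlled by [Dm - Dp + 3 c], which is
    continuous in [x] and tends to 0 when integrated against a fixed continuous compactly supported
    function. Second differences of [d] are bounded above but not below, because [d] may have
    concave ridges. Since the test weight [phi = |u| d^(1-s)] is nonnegative, only the positive part
    of the excess of the discrete Laplacian over its limiting bound has to vanish in the limit. The
    discrete product rule splits the differences of [phi]. Those of [|u|], paired with a unit
    vector, cost at most the gradient norm; those of [d^(1-s)] yield [-(s-1) d^(-s)] times the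
    squared length of the quotients [Dp], which is asymptotically 1. *)

Section ContinuousFun.
Variables (R : realType) (T : topologicalType).
Implicit Types f g : T -> R.

Lemma continuous_funD f g :
  continuous f -> continuous g -> continuous (fun x => f x + g x).
Proof. by move=> cf cg x; apply: cvgD; [exact: cf|exact: cg]. Qed.

Lemma continuous_funB f g :
  continuous f -> continuous g -> continuous (fun x => f x - g x).
Proof. by move=> cf cg x; apply: cvgB; [exact: cf|exact: cg]. Qed.

Lemma continuous_funM f g :
  continuous f -> continuous g -> continuous (fun x => f x * g x).
Proof. by move=> cf cg x; apply: cvgM; [exact: cf|exact: cg]. Qed.

Lemma continuous_fun_norm f : continuous f -> continuous (fun x => `|f x|).
Proof. by move=> cf x; apply: cvg_norm; exact: cf. Qed.

Lemma continuous_fun_cst (c : R) : continuous (fun _ : T => c).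
Proof. by move=> x; exact: cvg_cst. Qed.

Lemma continuous_fun_sum (I : finType) (F : I -> T -> R) :
  (forall i, continuous (F i)) -> continuous (fun x => \sum_i F i x).
Proof.
move=> cF; rewrite (_ : (fun x => _) = \sum_i F i); last first.
  by apply/funext => x; rewrite fct_sumE.
elim/big_ind : _ => [|f g cf cg|i _]; last exact: cF.
  exact: continuous_fun_cst.
exact: continuous_funD.
Qed.

Lemma continuous_fun_max f g :
  continuous f -> continuous g -> continuous (fun x => Num.max (f x) (g x)).
Proof.
move=> cf cg; have -> : (fun x => Num.max (f x) (g x)) =
    (fun x => (f x + g x + `|f x - g x|) / 2).
  by apply/funext => x; rewrite maxr_absE.
apply: continuous_funM; last exact: continuous_fun_cst.
apply: continuous_funD; first exact: continuous_funD.
by apply: continuous_fun_norm; exact: continuous_funB.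
Qed.

End ContinuousFun.

Section OneDim.
Variable R : realType.
Local Notation mu := (@lebesgue_measure R).
Implicit Types (F G : R -> R) (A M : R).

Lemma box_integrable A M : 0 <= A ->
  mu.-integrable [set: R] (fun x => (M * \1_(`[- A, A]%classic) x)%:E).
Proof.
move=> A0; have := integrable_indic_itv (- A) A true false.
by move=> /(integrableZl measurableT M).
Qed.

Lemma itv_measure a b : a <= b -> mu `[a, b]%classic = (b - a)%:E.
Proof.
move=> ab; rewrite lebesgue_measure_itv/= lte_fin; case: ltP => [|ba].
  by rewrite -EFinB.
by rewrite (_ : b - a = 0)//; lra.
Qed.

(** The right-hand side is the common integrable majorant for integrability, dominated convergence
    and the bound on the integral. *)
Lemma norm_le_box A M F x : (forall x, A < `|x| -> F x = 0) ->
  (forall x, `|F x| <= M) -> `|F x| <= M * \1_(`[- A, A]%classic) x.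
Proof.
move=> sF bF; rewrite indicE; case: (boolP (x \in _)) => xA.
  by rewrite mulr1.
rewrite mulr0 sF ?normr0//; rewrite ltNge; apply/negP => xA'.
by move/negP: xA; apply; rewrite inE/= in_itv/= -ler_norml.
Qed.

Lemma integrable1 F A M : 0 <= A -> continuous F ->
  (forall x, A < `|x| -> F x = 0) -> (forall x, `|F x| <= M) ->
  mu.-integrable [set: R] (EFin \o F).
Proof.
move=> A0 cF sF bF.
have := @le_integrable _ _ _ mu setT measurableT (EFin \o F) _ _ _ (box_integrable M A0).
apply.
  apply/measurable_EFinP; exact: continuous_measurable_fun.
move=> x _ /=; rewrite lee_fin.
apply: (le_trans (norm_le_box x sF bF)); exact: ler_norm.
Qed.

Lemma dominated1 (F_ : nat -> R -> R) F A M : 0 <= A ->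
  (forall j, continuous (F_ j)) ->
  (forall j x, A < `|x| -> F_ j x = 0) -> (forall j x, `|F_ j x| <= M) ->
  (forall x, F_ j x @[j --> \oo] --> F x) ->
  (\int[mu]_x (F_ j x)%:E)%E @[j --> \oo] --> (\int[mu]_x (F x)%:E)%E.
Proof.
move=> A0 cF sF bF FF.
apply: (@dominated_cvg _ _ _ mu setT measurableT (fun j x => (F_ j x)%:E)
  (fun x => (F x)%:E) (fun x => (M * \1_(`[- A, A]%classic) x)%:E)) => //.
- move=> j; apply/measurable_EFinP; exact: continuous_measurable_fun.
- by move=> x _; apply/cvg_EFin; [near=> j | exact: FF].
- exact: box_integrable.
- by move=> j x _ /=; rewrite lee_fin; apply: norm_le_box; [exact: sF|exact: bF].
Unshelve. all: by end_near. Qed.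

(** The factor [2 A] is the length of the interval; iterating it produces the [(2 A)^n] of
    [iint_good]. *)
Lemma integral1_bound F A M : 0 <= A -> continuous F ->
  (forall x, A < `|x| -> F x = 0) -> (forall x, `|F x| <= M) ->
  `|fine (\int[mu]_x (F x)%:E)%E| <= A *+ 2 * M.
Proof.
move=> A0 cF sF bF; have iF := integrable1 A0 cF sF bF.
have fF : (\int[mu]_x (F x)%:E)%E \is a fin_num by exact: integrable_fin_num.
rewrite -lee_fin.
have -> : (`|fine (\int[mu]_x (F x)%:E)|%:E = `|\int[mu]_x (F x)%:E|)%E.
  by rewrite -[in RHS](fineK fF).
apply: (le_trans (le_abse_integral mu measurableT _)).
  apply/measurable_EFinP; exact: continuous_measurable_fun.
apply: (@le_trans _ _ (\int[mu]_x (M * \1_(`[- A, A]%classic) x)%:E)%E).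
  apply: ge0_le_integral => //=.
  - apply/measurable_EFinP; apply: continuous_measurable_fun => x.
    apply: continuous_comp; [exact: cF|exact: norm_continuous].
  - by have /integrableP[] := box_integrable M A0.
  - by move=> x _; rewrite lee_fin; exact: norm_le_box.
under eq_integral do rewrite EFinM.
rewrite integralZl//; last exact: integrable_indic_itv.
rewrite integral_indic// setIT [X in (_ * X)%E](_ : _ = (A *+ 2)%:E).
  by rewrite -EFinM mulrC.
have AA : - A <= A by lra.
by apply: (eq_trans (itv_measure AA)); rewrite opprK mulr2n.
Qed.

Lemma integral1_lin F G a : mu.-integrable [set: R] (EFin \o F) ->
  mu.-integrable [set: R] (EFin \o G) ->
  fine (\int[mu]_x (a * F x + G x)%:E)%E =
  a * fine (\int[mu]_x (F x)%:E)%E + fine (\int[mu]_x (G x)%:E)%E.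
Proof.
move=> iF iG; have iaF := integrableZl measurableT a iF.
have fF := integrable_fin_num measurableT iF.
have fG := integrable_fin_num measurableT iG.
have -> : (\int[mu]_x (a * F x + G x)%:E =
    a%:E * \int[mu]_x (F x)%:E + \int[mu]_x (G x)%:E)%E.
  apply: (eq_trans (integralD measurableT iaF iG)).
  by congr (_ + _)%E; exact: (integralZl measurableT iF a).
by rewrite fineD ?fineM ?fin_numM.
Qed.

Lemma le_integral1 F G : mu.-integrable [set: R] (EFin \o F) ->
  mu.-integrable [set: R] (EFin \o G) -> (forall x, F x <= G x) ->
  fine (\int[mu]_x (F x)%:E)%E <= fine (\int[mu]_x (G x)%:E)%E.
Proof.
move=> iF iG FG; apply: fine_le.
- exact: (integrable_fin_num measurableT iF).
- exact: (integrable_fin_num measurableT iG).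
by apply: (le_integral measurableT iF iG) => x _; rewrite lee_fin.
Qed.

Lemma integral1_shift F A M c : 0 <= A -> continuous F ->
  (forall x, A < `|x| -> F x = 0) -> (forall x, `|F x| <= M) ->
  (\int[mu]_x (F (x + c))%:E = \int[mu]_x (F x)%:E)%E.
Proof.
move=> A0 cF sF bF.
have dshift : derive1 (fun x : R => x + c) = cst 1.
  by apply/funext => z; rewrite derive1E (@derive_val _ _ _ _ _ _ _ (is_derive_shift z 1 c)).
(* The change of variables is made for nonnegative [G]; the signed case follows from the positive
   and negative parts of [F], which are again continuous. *)
have key G : continuous G -> (forall x, 0 <= G x) ->
    (\int[mu]_x (G (x + c))%:E = \int[mu]_x (G x)%:E)%E.
  move=> cG G0.
  rewrite [RHS](@increasing_ge0_integration_by_substitutionT _ (fun x => x + c)) //.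
  - by apply: eq_integral => x _; rewrite dshift !fctE mulr1.
  - by move=> x y xy; rewrite ltrD2r.
  - by rewrite dshift; exact: cst_continuous.
  - by rewrite dshift; exact: is_cvg_cst.
  - by rewrite dshift; exact: is_cvg_cst.
  - apply/cvgrNyPle => B; exists (B - c); split => [|x /= xB]; [exact: num_real|lra].
  - apply/cvgryPge => B; exists (B - c); split => [|x /= xB]; [exact: num_real|lra].
rewrite integralE [RHS]integralE.
have e1 : forall H : R -> R, ((fun x => (H x)%:E)^\+ = (fun x => (Num.max (H x) 0)%:E))%E.
  by move=> H; apply/funext => x; rewrite funeposE EFin_max.
have e2 : forall H : R -> R, ((fun x => (H x)%:E)^\- = (fun x => (Num.max (- H x) 0)%:E))%E.
  by move=> H; apply/funext => x; rewrite funenegE EFin_max EFinN.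
rewrite (e1 F) (e2 F) (e1 (fun x => F (x + c))) (e2 (fun x => F (x + c))); congr (_ - _)%E.
  apply: (key (fun x => Num.max (F x) 0)).
    by apply: continuous_fun_max => // x; exact: cvg_cst.
  by move=> x; rewrite le_max lexx orbT.
apply: (key (fun x => Num.max (- F x) 0)).
  apply: continuous_fun_max => x; last exact: cvg_cst.
  by apply: continuousN; exact: cF.
by move=> x; rewrite le_max lexx orbT.
Unshelve. all: by end_near. Qed.

Lemma integral1_gt0 F A M x0 : 0 <= A -> continuous F ->
  (forall x, A < `|x| -> F x = 0) -> (forall x, `|F x| <= M) ->
  (forall x, 0 <= F x) -> 0 < F x0 -> 0 < fine (\int[mu]_x (F x)%:E)%E.
Proof.
move=> A0 cF sF bF F0 Fx0; have iF := integrable1 A0 cF sF bF.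
have fF : (\int[mu]_x (F x)%:E)%E \is a fin_num by exact: integrable_fin_num.
(* By continuity [F] stays above half its value at [x0] on a whole interval, and the integral
   dominates that of the corresponding step function. *)
have [e /= e0 He] : exists2 e, 0 < e & forall x, `|x0 - x| <= e -> F x0 / 2 <= F x.
  have h : 0 < F x0 / 2 by rewrite divr_gt0.
  have /cvgrPdist_le/(_ _ h)/nbhs_ballP[e /= e0 He] := cF x0.
  exists (e / 2); first by rewrite divr_gt0.
  move=> x xe; have : `|F x0 - F x| <= F x0 / 2.
    by apply: He; rewrite /ball/= (le_lt_trans xe)//; lra.
  by rewrite ler_norml => /andP[_]; lra.
rewrite -lte_fin fineK//.
apply: (@lt_le_trans _ _ (\int[mu]_x ((F x0 / 2)%:E * (\1_(`[x0 - e, x0 + e]%classic) x)%:E))%E).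
  rewrite integralZl//; last exact: integrable_indic_itv.
  rewrite integral_indic// setIT [X in (_ * X)%E](_ : _ = (x0 + e - (x0 - e))%:E).
    by rewrite -EFinM lte_fin mulr_gt0 ?divr_gt0//; lra.
  by apply: itv_measure; lra.
apply: ge0_le_integral => //=.
- by move=> x _; rewrite -EFinM lee_fin mulr_ge0// ?divr_ge0// ltW.
- by apply/measurable_EFinP; apply: measurable_funM => //; exact: measurable_indic.
- apply/measurable_EFinP; exact: continuous_measurable_fun.
move=> x _; rewrite -EFinM lee_fin indicE; case: (boolP (x \in _)) => xA; last by rewrite mulr0.
rewrite mulr1; apply: He; move: xA; rewrite inE/= in_itv/= ler_norml => /andP[]; lra.
Qed.

End OneDim.

(** * Iterated integrals of continuous compactly supported functions *)

Section Cc.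
Variable R : realType.

Lemma rV_norm_le n (x : 'rV[R]_n) e : 0 <= e -> (forall i, `|x 0 i| <= e) -> `|x| <= e.
Proof.
move=> e0 h; rewrite [leLHS]/Num.Def.normr/= mx_normrE (bigmax_le _ e0)//= => -[i j] _ /=.
by rewrite (ord1 i).
Qed.

Lemma rV_norm_coord n (x : 'rV[R]_n) i : `|x 0 i| <= `|x|.
Proof.
by rewrite [leRHS]/Num.Def.normr/= mx_normrE; apply/bigmax_geP; right => /=; exists (0, i).
Qed.

Lemma continuous_shift_fun (V : normedModType R) (f : V -> R) a : continuous f -> continuous (fun x => f (x + a)).
Proof.
move=> cf x; apply: (@continuous_comp _ _ _ (fun x => x + a) f); last exact: cf.
by apply: cvgD; [exact: cvg_id|exact: cvg_cst].
Qed.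

(** Written exactly as in [iint], so that slices of an integrand are convertible to its inner
    integrands. *)
Definition cons_rV k (t : R) (v : 'rV[R]_k) : 'rV[R]_k.+1 :=
  row_mx (const_mx t : 'rV_1) v.

Lemma cons_rV0 k t (v : 'rV[R]_k) : cons_rV t v 0 0 = t.
Proof.
transitivity (row_mx (const_mx t : 'rV_1) v 0 (lshift k 0)).
  by congr (fun_of_matrix _ _ _); apply/val_inj.
by rewrite row_mxEl mxE.
Qed.

Lemma cons_rVS k t (v : 'rV[R]_k) i : cons_rV t v 0 (rshift 1 i) = v 0 i.
Proof. exact: (row_mxEr (const_mx t : 'rV_1) v 0 i). Qed.

Lemma cons_rV_ind k (P : 'I_k.+1 -> Prop) :
  P 0 -> (forall i : 'I_k, P (rshift 1 i)) -> forall i, P i.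
Proof.
move=> P0 Ps i; case: (@splitP 1 k i) => j ij.
  by rewrite (_ : i = 0)//; apply/val_inj; rewrite /= ij (ord1 j).
by rewrite (_ : i = rshift 1 j)//; apply/val_inj.
Qed.

Lemma cons_rVD k t t' (v v' : 'rV[R]_k) :
  cons_rV t v + cons_rV t' v' = cons_rV (t + t') (v + v').
Proof.
by apply/rowP; apply: cons_rV_ind => [|i]; rewrite mxE ?cons_rV0 // !cons_rVS mxE.
Qed.

Lemma cons_rVN k t (v : 'rV[R]_k) : - cons_rV t v = cons_rV (- t) (- v).
Proof.
by apply/rowP; apply: cons_rV_ind => [|i]; rewrite mxE ?cons_rV0 // !cons_rVS mxE.
Qed.

Lemma cons_rV_eta k (x : 'rV[R]_k.+1) : exists t v, x = cons_rV t v.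
Proof.
exists (x 0 0), (\row_i x 0 (rshift 1 i)); apply/rowP.
by apply: cons_rV_ind => [|i]; rewrite ?cons_rV0 // !cons_rVS mxE.
Qed.

Lemma norm_cons_rV_ge k t (v : 'rV[R]_k) : `|t| <= `|cons_rV t v| /\ `|v| <= `|cons_rV t v|.
Proof.
split; first by rewrite -[X in `|X|](cons_rV0 t v) rV_norm_coord.
by apply: rV_norm_le => // i; rewrite -(cons_rVS t v) rV_norm_coord.
Qed.

Lemma norm_cons_rV_le k t (v : 'rV[R]_k) : `|cons_rV t v| <= `|t| + `|v|.
Proof.
apply: rV_norm_le; first exact: addr_ge0.
apply: cons_rV_ind => [|i]; rewrite ?cons_rV0 ?cons_rVS; first by rewrite lerDl.
by rewrite (le_trans (rV_norm_coord v i))// lerDr.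
Qed.

Lemma continuous_cons_rV_l k (v : 'rV[R]_k) : continuous (fun t : R => cons_rV t v).
Proof.
move=> t; apply/cvgrPdist_le => e e0; apply/nbhs_ballP; exists e => //= u tu.
rewrite cons_rVN cons_rVD subrr (le_trans (norm_cons_rV_le _ _))// normr0 addr0.
exact: ltW.
Qed.

Lemma continuous_cons_rV_r k (t : R) : continuous (fun v : 'rV[R]_k => cons_rV t v).
Proof.
move=> v; apply/(@cvgrPdist_le _ _ _ (nbhs v) (nbhs_filter v)) => e e0; apply/nbhs_ballP; exists e => //= w.
rewrite -ball_normE /= => vw.
rewrite cons_rVN cons_rVD subrr (le_trans (norm_cons_rV_le _ _))// normr0 add0r.
exact: ltW.
Qed.

(** The norm on row vectors is the maximum norm, so the support lies in a cube of half-side [A], and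
    every slice keeps the same [A]. *)
Definition cc n A (f : 'rV[R]_n -> R) := continuous f /\ forall x, A < `|x| -> f x = 0.

Lemma cc_bounded n A (f : 'rV[R]_n -> R) : 0 <= A -> cc A f ->
  exists2 M, 0 <= M & forall x, `|f x| <= M.
Proof.
move=> A0 [cf sf].
have cA : compact [set x : 'rV[R]_n | `|x| <= A].
  apply: bounded_closed_compact.
    by exists A; split => [|B AB x /= xA]; [exact: num_real|exact: le_trans xA (ltW AB)].
  apply: (@closed_comp _ _ (fun x : 'rV[R]_n => `|x|) [set y | y <= A]).
    by move=> x _; exact: norm_continuous.
  exact: closed_le.
have A0' : [set x : 'rV[R]_n | `|x| <= A] !=set0 by exists 0; rewrite /= normr0.
have cfA : {within [set x : 'rV[R]_n | `|x| <= A], continuous (fun x => `|f x|)}.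
  apply: continuous_subspaceT => x.
  by apply: (@continuous_comp _ _ _ f); [exact: cf|exact: norm_continuous].
have [c _ Hc] := compact_EVT_max A0' cA cfA.
exists `|f c| => // x; have [xA|xA] := leP `|x| A; first by apply: Hc; rewrite inE.
by rewrite sf// normr0.
Qed.

Definition slice k (f : 'rV[R]_k.+1 -> R) t : 'rV[R]_k -> R := fun v => f (cons_rV t v).

Lemma cc_slice k A (f : 'rV[R]_k.+1 -> R) t : cc A f -> cc A (slice f t).
Proof.
move=> [cf sf]; split.
  move=> v; apply: continuous_comp; [exact: continuous_cons_rV_r|exact: cf].
by move=> v Av; apply: sf; apply: lt_le_trans Av (norm_cons_rV_ge t v).2.
Qed.

Lemma slice_out k A (f : 'rV[R]_k.+1 -> R) t : cc A f -> A < `|t| -> slice f t = cst 0.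
Proof.
move=> [cf sf] At; apply/funext => v; apply: sf.
exact: lt_le_trans At (norm_cons_rV_ge t v).1.
Qed.

(** No information is lost by [fine] on the class [cc]: the first clause of [iint_good] says that
    the iterated integral is finite there. *)
Definition Int n (f : 'rV[R]_n -> R) : R := fine (iint (EFin \o f)).

Local Notation mu := (@lebesgue_measure R).

(* The invariant of the induction on the dimension: the second clause, applied in
   dimension k, makes the inner integral a continuous function of the outer
   variable in dimension k + 1. *)
Definition iint_good n A := 
  [/\ (forall f : 'rV[R]_n -> R, cc A f -> iint (EFin \o f) = (Int f)%:E),
      (forall (f_ : nat -> 'rV[R]_n -> R) f M, (forall j, cc A (f_ j)) ->
        cc A f -> (forall j x, `|f_ j x| <= M) ->
        (forall x, f_ j x @[j --> \oo] --> f x) ->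
        Int (f_ j) @[j --> \oo] --> Int f) &
      (forall (f : 'rV[R]_n -> R) M, cc A f -> (forall x, `|f x| <= M) ->
        `|Int f| <= (A *+ 2) ^+ n * M)].

Lemma cc0 n A : cc A (cst 0 : 'rV[R]_n -> R).
Proof. by split => //; exact: cst_continuous. Qed.

Section Step.
Variables (k : nat) (A : R).
Hypotheses (A0 : 0 <= A) (good : iint_good k A).

(** The integral bound with [M = 0]. *)
Lemma Int0_step : Int (cst 0 : 'rV[R]_k -> R) = 0.
Proof.
have [_ _ /(_ (cst 0) 0 (cc0 _ _))] := good.
by rewrite mulr0 normr_le0 => h; apply/eqP/h => x; rewrite normr0.
Qed.

Lemma Int_slice_continuous (f : 'rV[R]_k.+1 -> R) :
  cc A f -> continuous (fun t => Int (slice f t) : R).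
Proof.
move=> cf t; have [M M0 fM] := cc_bounded A0 cf; have [_ lim _] := good.
(* Continuity is tested along sequences tending to [t] and avoiding it, to which the dominated
   convergence clause in dimension [k] applies. *)
apply/continuous_withinNx; apply/cvgr_dnbhsP => u [_ ut].
apply: (lim _ _ M) => [j||j x|x]; [exact: cc_slice|exact: cc_slice|exact: fM|].
apply: (@cvg_comp _ _ _ u (fun t => f (cons_rV t x)) _ _ _ ut).
apply: (@continuous_comp _ _ _ (fun t => cons_rV t x) f).
  exact: continuous_cons_rV_l.
exact: cf.1.
Qed.

Lemma Int_slice_out (f : 'rV[R]_k.+1 -> R) t : cc A f -> A < `|t| -> Int (slice f t) = 0.
Proof. by move=> cf At; rewrite (slice_out cf At) Int0_step. Qed.

Lemma Int_slice_bound (f : 'rV[R]_k.+1 -> R) M t : cc A f -> (forall x, `|f x| <= M) ->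
  `|Int (slice f t)| <= (A *+ 2) ^+ k * M.
Proof.
move=> cf fM; have [_ _ h] := good.
by apply: h; [exact: cc_slice|move=> v; exact: fM].
Qed.

Lemma iint_step (f : 'rV[R]_k.+1 -> R) : cc A f ->
  iint (EFin \o f) = (\int[mu]_t (Int (slice f t))%:E)%E.
Proof.
move=> cf /=; apply: eq_integral => t _; have [h _ _] := good.
exact: (h (slice f t) (cc_slice t cf)).
Qed.

Lemma Int_step (f : 'rV[R]_k.+1 -> R) : cc A f ->
  Int f = fine (\int[mu]_t (Int (slice f t))%:E)%E.
Proof. by move=> cf; rewrite /Int iint_step. Qed.

Lemma slice_integrable (f : 'rV[R]_k.+1 -> R) : cc A f ->
  mu.-integrable [set: R] (EFin \o (fun t => Int (slice f t))).
Proof.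
move=> cf; have [M M0 fM] := cc_bounded A0 cf.
apply: (integrable1 A0 (M := (A *+ 2) ^+ k * M)).
- exact: Int_slice_continuous.
- by move=> x; exact: Int_slice_out.
- by move=> x; exact: Int_slice_bound.
Qed.

Lemma iint_good_step : iint_good k.+1 A.
Proof.
split.
- move=> f cf; rewrite /Int fineK// iint_step//.
  by apply: integrable_fin_num => //; exact: slice_integrable.
- move=> f_ f M cf_ cf fM flim; rewrite Int_step//.
  have -> : (fun j => Int (f_ j)) = (fun j => fine (\int[mu]_t (Int (slice (f_ j) t))%:E)%E).
    by apply/funext => j; rewrite Int_step.
  apply: fine_cvg; rewrite fineK; last first.
    by apply: integrable_fin_num => //; exact: slice_integrable.
  apply: (dominated1 (M := (A *+ 2) ^+ k * M) A0).
  + by move=> j; exact: Int_slice_continuous.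
  + by move=> j x; exact: Int_slice_out.
  + by move=> j x; apply: Int_slice_bound => // y; exact: fM.
  + move=> t; have [_ lim _] := good.
    apply: (lim _ _ M) => [j||j x|x]; [exact: cc_slice|exact: cc_slice|exact: fM|].
    exact: flim.
- move=> f M cf fM; rewrite Int_step// exprS -mulrA.
  apply: integral1_bound => //.
  + exact: Int_slice_continuous.
  + by move=> x; exact: Int_slice_out.
  + by move=> x; exact: Int_slice_bound.
Qed.

End Step.

Lemma iint_goodP n A : 0 <= A -> iint_good n A.
Proof.
move=> A0; elim: n => [|k IH]; last exact: iint_good_step.
split=> [//|f_ f M _ _ _ lim|f M _ fM]; last by rewrite expr0 mul1r; exact: fM.
exact: lim.
Qed.

(** * Linearity, monotonicity, positivity and translation invariance in every dimension *)

Section Properties.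
Variable A : R.
Hypothesis A0 : 0 <= A.

Lemma Int_dominated n (f_ : nat -> 'rV[R]_n -> R) f M : (forall j, cc A (f_ j)) ->
  cc A f -> (forall j x, `|f_ j x| <= M) ->
  (forall x, f_ j x @[j --> \oo] --> f x) -> Int (f_ j) @[j --> \oo] --> Int f.
Proof. by have [_ h _] := iint_goodP n A0; exact: h. Qed.

Lemma cc_lin n (f g : 'rV[R]_n -> R) a : cc A f -> cc A g -> cc A (fun x => a * f x + g x).
Proof.
move=> [cf sf] [cg sg]; split => [|x xA]; last by rewrite sf// sg// mulr0 addr0.
by apply: continuous_funD => //; apply: continuous_funM => //; exact: continuous_fun_cst.
Qed.

Lemma Int_lin n (f g : 'rV[R]_n -> R) a : cc A f -> cc A g ->
  Int (fun x => a * f x + g x) = a * Int f + Int g.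
Proof.
elim: n f g => [//|k IH] f g cf cg.
have gk := iint_goodP k A0.
rewrite (Int_step gk); last exact: cc_lin.
have hf := slice_integrable A0 gk cf; have hg := slice_integrable A0 gk cg.
rewrite !(Int_step gk)//.
rewrite -(integral1_lin a hf hg); congr fine; apply: eq_integral => t _; congr EFin.
by rewrite -IH//; exact: cc_slice.
Qed.

Lemma le_Int n (f g : 'rV[R]_n -> R) : cc A f -> cc A g -> (forall x, f x <= g x) ->
  Int f <= Int g.
Proof.
elim: n f g => [f g _ _ fg|k IH f g cf cg fg]; first exact: fg.
have gk := iint_goodP k A0.
rewrite !(Int_step gk)//.
apply: (le_integral1 (slice_integrable A0 gk cf) (slice_integrable A0 gk cg)).
by move=> t; apply: IH; [exact: cc_slice|exact: cc_slice|move=> v; exact: fg].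
Qed.

Lemma Int_gt0 n (f : 'rV[R]_n -> R) x0 : cc A f -> (forall x, 0 <= f x) -> 0 < f x0 -> 0 < Int f.
Proof.
elim: n f x0 => [f x0 _ _ f0|k IH f x0 cf f0 fx0].
  by move: f0; rewrite (_ : x0 = 0)//; apply/rowP => -[].
have gk := iint_goodP k A0; have [M M0 fM] := cc_bounded A0 cf.
have [t [v xtv]] := cons_rV_eta x0.
rewrite (Int_step gk)//; apply: (integral1_gt0 (A := A) (M := (A *+ 2) ^+ k * M) (x0 := t)) => //.
- exact: (Int_slice_continuous A0 gk cf).
- by move=> x; exact: (Int_slice_out gk cf).
- by move=> x; exact: (Int_slice_bound gk _ cf).
- move=> x; rewrite -(Int0_step gk); apply: le_Int; [exact: cc0|exact: cc_slice|].
  by move=> w; exact: f0.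
- by apply: (IH _ v); [exact: cc_slice|move=> w; exact: f0|rewrite /slice -xtv].
Qed.

Lemma cc_shift n (f : 'rV[R]_n -> R) B a : cc B f -> cc (B + `|a|) (fun x => f (x + a)).
Proof.
move=> [cf sf]; split=> [|x xA]; first exact: continuous_shift_fun.
apply: sf; rewrite -(ltrD2r `|a|) (lt_le_trans xA)//.
by rewrite -[X in `|X| <= _](addrK a) (le_trans (ler_normB _ _)).
Qed.

Lemma Int_shift n (f : 'rV[R]_n -> R) a : cc A f -> Int (fun x => f (x + a)) = Int f.
Proof.
elim: n f a => [f a _|k IH f a cf].
  by rewrite /Int/= (_ : a = 0) ?addr0//; apply/rowP => -[].
have gk := iint_goodP k A0; have [M M0 fM] := cc_bounded A0 cf.
have [t [v atv]] := cons_rV_eta a.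
rewrite (Int_step gk cf) -(integral1_shift t A0 (Int_slice_continuous A0 gk cf)
  (fun x => @Int_slice_out _ _ gk f x cf) (fun x => Int_slice_bound gk x cf fM)).
rewrite [LHS]/Int; congr fine; apply: eq_integral => u _.
rewrite -(IH _ v); last exact: cc_slice.
(* The translated slice lives in the larger cube of half-side [A + |v|]; finiteness is needed there
   to return from [Int] to [iint]. *)
have [h _ _] := iint_goodP k (addr_ge0 A0 (normr_ge0 v)).
rewrite -h; last exact/cc_shift/cc_slice.
by congr iint; apply/funext => w /=; rewrite /slice atv -cons_rVD.
Qed.

End Properties.
End Cc.

(** * Euclidean norm and distance to the complement *)

Section Euclid.
Variable R : realType.
Implicit Types n : nat.

Lemma cauchy_schwarz_sq (I : finType) (a b : I -> R) :
  (\sum_i a i * b i) ^+ 2 <= (\sum_i a i ^+ 2) * (\sum_i b i ^+ 2).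
Proof.
set C := \sum_i _; set A := \sum_i _; set B := \sum_i _.
have A0 : 0 <= A by apply: sumr_ge0 => i _; exact: sqr_ge0.
have B0 : 0 <= B by apply: sumr_ge0 => i _; exact: sqr_ge0.
have H s : 0 <= A - s * C *+ 2 + s ^+ 2 * B.
  have -> : A - s * C *+ 2 + s ^+ 2 * B = \sum_i (a i - s * b i) ^+ 2.
    rewrite /A /B /C !mulr_sumr -sumrMnl -sumrN -!big_split /=.
    by apply: eq_bigr => i _; ring.
  by apply: sumr_ge0 => i _; exact: sqr_ge0.
have [B00|Bp] := eqVneq B 0.
  have b0 i : b i = 0.
    have /eqP := B00; rewrite psumr_eq0 => [/allP/(_ i)|j _]; last exact: sqr_ge0.
    by rewrite mem_index_enum => /(_ isT)/=; rewrite sqrf_eq0 => /eqP.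
  by rewrite /C big1 ?expr0n ?mulr_ge0// => i _; rewrite b0 mulr0.
(* [C / B] minimizes the nonnegative quadratic in [s]. *)
have := H (C / B); have -> : A - C / B * C *+ 2 + (C / B) ^+ 2 * B = A - C ^+ 2 / B.
  by field.
by rewrite subr_ge0 ler_pdivrMr// lt_neqAle eq_sym Bp.
Qed.

Lemma cauchy_schwarz (I : finType) (a b : I -> R) :
  \sum_i a i * b i <= Num.sqrt (\sum_i a i ^+ 2) * Num.sqrt (\sum_i b i ^+ 2).
Proof.
apply: (le_trans (ler_norm _)).
rewrite -sqrtr_sqr -sqrtrM; last by apply: sumr_ge0 => i _; exact: sqr_ge0.
by rewrite ler_sqrt ?cauchy_schwarz_sq// mulr_ge0//; apply: sumr_ge0 => i _; exact: sqr_ge0.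
Qed.

Lemma enorm_ge0 n (x : 'rV[R]_n) : 0 <= enorm x.
Proof. exact: sqrtr_ge0. Qed.

Lemma enorm_sq n (x : 'rV[R]_n) : enorm x ^+ 2 = \sum_i x 0 i ^+ 2.
Proof. by rewrite sqr_sqrtr//; apply: sumr_ge0 => i _; exact: sqr_ge0. Qed.

Lemma enormD n (x y : 'rV[R]_n) : enorm (x + y) <= enorm x + enorm y.
Proof.
rewrite -(@ler_pXn2r _ 2)// ?nnegrE ?addr_ge0 ?enorm_ge0//.
rewrite enorm_sq sqrrD !enorm_sq.
have -> : \sum_i (x + y) 0 i ^+ 2 =
    \sum_i x 0 i ^+ 2 + (\sum_i x 0 i * y 0 i) *+ 2 + \sum_i y 0 i ^+ 2.
  by rewrite -sumrMnl -!big_split/=; apply: eq_bigr => i _; rewrite mxE; ring.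
by rewrite lerD2r lerD2l ler_wMn2r// cauchy_schwarz.
Qed.

Lemma enormN n (x : 'rV[R]_n) : enorm (- x) = enorm x.
Proof. by congr Num.sqrt; apply: eq_bigr => i _; rewrite mxE sqrrN. Qed.

Lemma enormB n (x y : 'rV[R]_n) : enorm (x - y) = enorm (y - x).
Proof. by rewrite -enormN opprB. Qed.

Lemma enorm_tri n (x y z : 'rV[R]_n) : enorm (x - z) <= enorm (x - y) + enorm (y - z).
Proof. by rewrite (le_trans _ (enormD _ _))// addrA subrK. Qed.

Lemma enormZ n c (x : 'rV[R]_n) : enorm (c *: x) = `|c| * enorm x.
Proof.
rewrite -sqrtr_sqr -sqrtrM ?sqr_ge0//; congr Num.sqrt.
by rewrite mulr_sumr; apply: eq_bigr => i _; rewrite mxE exprMn.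
Qed.

Lemma enorm0 n : enorm (0 : 'rV[R]_n) = 0.
Proof. by rewrite -(scale0r 0) enormZ normr0 mul0r. Qed.

Lemma enorm_delta n (i : 'I_n) : enorm (delta_mx 0 i : 'rV[R]_n) = 1.
Proof.
rewrite -[RHS]sqrtr1; congr Num.sqrt; rewrite (bigD1 i)//= mxE !eqxx expr1n.
by rewrite big1 ?addr0// => j ji; rewrite mxE (negbTE ji) andbF expr0n.
Qed.

Lemma coord_le_enorm n (x : 'rV[R]_n) i : `|x 0 i| <= enorm x.
Proof.
rewrite -sqrtr_sqr ler_sqrt ?sumr_ge0// => [|j _]; last exact: sqr_ge0.
by rewrite (bigD1 i)//= lerDl sumr_ge0// => j _; exact: sqr_ge0.
Qed.

Lemma norm_le_enorm n (x : 'rV[R]_n) : `|x| <= enorm x.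
Proof. by apply: rV_norm_le; [exact: enorm_ge0|exact: coord_le_enorm]. Qed.

Lemma enorm_le_norm n (x : 'rV[R]_n) : enorm x <= Num.sqrt n%:R * `|x|.
Proof.
rewrite -[`|x|]normr_id -sqrtr_sqr -sqrtrM// ler_sqrt; last by rewrite mulr_ge0// sqr_ge0.
have -> : n%:R * `|x| ^+ 2 = \sum_(i < n) `|x| ^+ 2 by rewrite sumr_const card_ord mulr_natl.
apply: ler_sum => i _; rewrite -[x 0 i ^+ 2]real_normK ?num_real//.
by apply: lerXn2r; rewrite ?nnegrE//; exact: rV_norm_coord.
Qed.

Lemma enorm_eq0 n (x : 'rV[R]_n) : enorm x = 0 -> x = 0.
Proof.
move=> x0; apply/rowP => i; rewrite mxE; apply/eqP.
by rewrite -normr_le0 -x0 coord_le_enorm.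
Qed.

Lemma lipschitz_continuous n (f : 'rV[R]_n -> R) c :
  (forall x y, `|f x - f y| <= c * enorm (x - y)) -> continuous f.
Proof.
move=> lf x; apply/(@cvgrPdist_le _ _ _ (nbhs x) (nbhs_filter x)) => e e0.
(* The topology is that of the maximum norm, whence the factor [sqrt n]; the added 1 keeps the
   divisor positive when the product is 0. *)
have K0 : 0 < `|c| * Num.sqrt n%:R + 1 by rewrite ltr_pwDr ?mulr_ge0 ?sqrtr_ge0.
apply/nbhs_ballP; exists (e / (`|c| * Num.sqrt n%:R + 1)) => /=; first by rewrite divr_gt0.
move=> y; rewrite -ball_normE /= => xy.
rewrite (le_trans (lf _ _))// (le_trans (ler_wpM2r (enorm_ge0 _) (ler_norm c)))//.
rewrite (le_trans (ler_wpM2l (normr_ge0 c) (enorm_le_norm _)))//.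
rewrite mulrA (le_trans (ler_wpM2l _ (ltW xy))) ?mulr_ge0 ?sqrtr_ge0//.
by rewrite mulrCA ger_pMr// ler_pdivrMr// mul1r lerDl.
Qed.

Variables (n : nat) (Om : set 'rV[R]_n).
Hypotheses (oOm : open Om) (Om0 : ~` Om !=set0).
Local Notation d := (dist_compl Om).

Lemma dist_lbound x : has_lbound [set enorm (x - z) | z in ~` Om].
Proof. by exists 0 => _ [z _ <-]; exact: enorm_ge0. Qed.

Lemma dist_le x z : ~ Om z -> d x <= enorm (x - z).
Proof. by move=> zO; apply: ge_inf; [exact: dist_lbound|exists z]. Qed.

Lemma dist_ge x m : (forall z, ~ Om z -> m <= enorm (x - z)) -> m <= d x.
Proof.
move=> H; apply: lb_le_inf; last by move=> _ [z zO <-]; exact: H.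
by have [z zO] := Om0; exists (enorm (x - z)), z.
Qed.

Lemma dist_lip x y : d x <= d y + enorm (x - y).
Proof.
rewrite -lerBlDr; apply: dist_ge => z zO; rewrite lerBlDr.
by rewrite (le_trans (dist_le x zO))// [leRHS]addrC enorm_tri.
Qed.

Lemma dist_lip_norm x y : `|d x - d y| <= enorm (x - y).
Proof.
by rewrite ler_norml lerNl opprB !lerBlDl enormB dist_lip enormB dist_lip.
Qed.

Lemma dist_shift_norm x v : `|d (x + v) - d x| <= enorm v.
Proof. by rewrite (le_trans (dist_lip_norm _ _))// addrC addKr. Qed.

Lemma continuous_dist : continuous d.
Proof. by apply: (@lipschitz_continuous _ _ 1) => x y; rewrite mul1r dist_lip_norm. Qed.

Lemma dist_attained x : exists2 y, ~ Om y & enorm (x - y) = d x.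
Proof.
have [z0 z0O] := Om0.
have cxz : continuous (fun z : 'rV[R]_n => enorm (x - z)).
  apply: (@lipschitz_continuous _ _ 1) => u v; rewrite mul1r.
  have h (a b : 'rV[R]_n) : enorm (x - a) - enorm (x - b) <= enorm (a - b).
    by rewrite lerBlDr [leLHS]enormB [enorm (x - b)]enormB; exact: enorm_tri.
  by rewrite ler_norml lerNl opprB h enormB h.
(* Only points of the complement at least as close as [z0] compete, and they form a compact set. *)
pose K := [set z : 'rV[R]_n | enorm (x - z) <= enorm (x - z0)] `&` ~` Om.
have cK : compact K.
  apply: bounded_closed_compact.
    exists (`|x| + enorm (x - z0)); split => [|B AB z /= [xz _]]; first exact: num_real.
    rewrite (le_trans _ (ltW AB))// -[z](subKr x) (le_trans (ler_normB _ _))// lerD2l.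
    by rewrite (le_trans (norm_le_enorm _)).
  apply: closedI; last exact: open_closedC.
  apply: (@closed_comp _ _ (fun z : 'rV[R]_n => enorm (x - z)) [set y | y <= enorm (x - z0)]).
    by move=> z _; exact: cxz.
  exact: closed_le.
have K0 : K !=set0 by exists z0; split => /=.
have [y] := compact_EVT_min K0 cK (continuous_subspaceT cxz).
rewrite inE => -[yz0 yO] ymin; exists y => //.
apply/eqP; rewrite eq_le dist_le// andbT; apply: dist_ge => z zO.
have [zz0|zz0] := leP (enorm (x - z)) (enorm (x - z0)).
  by apply: ymin; rewrite inE.
by rewrite (le_trans yz0)// ltW.
Qed.

Lemma dist_gt0 x : Om x -> 0 < d x.
Proof.
move=> xO; have [y yO <-] := dist_attained x; rewrite lt_neqAle enorm_ge0 andbT.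
apply/eqP => /esym/enorm_eq0/eqP; rewrite subr_eq0 => /eqP xy.
by apply: yO; rewrite -xy.
Qed.

Lemma dist_ball x z : enorm (x - z) < d x -> Om z.
Proof. by move=> H; apply: contrapT => /(dist_le x); rewrite leNgt H. Qed.

Lemma nearest_bdry x y : Om x -> ~ Om y -> enorm (x - y) = d x -> bdry Om y.
Proof.
move=> xO yO xy; split => //; have d0 := dist_gt0 xO.
move=> B /nbhs_ballP[e /= e0 eB].
(* The point [y + l (x - y)] has distance [(1 - l) d x < d x] from [x], hence lies in [Om]; the
   second bound on [l] puts it within [e / 2] of [y]. *)
pose l := Num.min 1 (e / (2 * d x)).
have l0 : 0 < l by rewrite lt_min ltr01 divr_gt0// mulr_gt0.
have l1 : l <= 1 by rewrite ge_min lexx.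
exists (y + l *: (x - y)); split.
  apply: (@dist_ball x).
  have -> : x - (y + l *: (x - y)) = (1 - l) *: (x - y).
    by rewrite opprD addrA scalerBl scale1r.
  by rewrite enormZ xy ger0_norm ?subr_ge0// gtr_pMl//; lra.
apply: eB; rewrite -ball_normE /= opprD addNKr normrN.
rewrite (le_lt_trans (norm_le_enorm _))// enormZ gtr0_norm// xy.
have : l <= e / (2 * d x) by rewrite ge_min lexx orbT.
rewrite ler_pdivlMr ?mulr_gt0// => h.
have : l * d x * 2 <= e by rewrite -mulrA [d x * 2]mulrC.
by move: e0; lra.
Qed.

(* AM-GM: [|x + v - y| <= (|x + v - y|^2 + |x - y|^2) / (2 |x - y|)]. *)
Lemma dist_superdiff x : Om x -> exists2 nu : 'rV[R]_n, \sum_i nu 0 i ^+ 2 = 1 &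
  forall v, d (x + v) <= d x + \sum_i nu 0 i * v 0 i + enorm v ^+ 2 / (2 * d x).
Proof.
move=> xO; have d0 := dist_gt0 xO; have [y yO xy] := dist_attained x.
have dn0 : d x != 0 by rewrite gt_eqF.
exists ((d x)^-1 *: (x - y)) => [|v].
  by rewrite -enorm_sq enormZ xy gtr0_norm ?invr_gt0// mulVf ?expr1n.
apply: (le_trans (dist_le (x + v) yO)).
have e1 : enorm (x + v - y) ^+ 2 =
    d x ^+ 2 + 2 * \sum_i (x - y) 0 i * v 0 i + enorm v ^+ 2.
  rewrite -xy !enorm_sq mulr_sumr -!big_split/=; apply: eq_bigr => i _.
  by rewrite !mxE; ring.
have -> : d x + \sum_i ((d x)^-1 *: (x - y)) 0 i * v 0 i + enorm v ^+ 2 / (2 * d x) =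
   (enorm (x + v - y) ^+ 2 + d x ^+ 2) / (2 * d x).
  rewrite e1 (_ : \sum_i _ = (d x)^-1 * \sum_i (x - y) 0 i * v 0 i); last first.
    by rewrite mulr_sumr; apply: eq_bigr => i _; rewrite !mxE mulrA.
  by field.
rewrite ler_pdivlMr ?mulr_gt0//; set a := enorm _.
by rewrite -subr_ge0 (_ : _ - _ = (a - d x) ^+ 2) ?sqr_ge0//; ring.
Qed.

End Euclid.

(** * Second differences and boundary charts *)

Section Calculus.
Variable R : realType.

Lemma is_derive_line n (f : 'rV[R]_n -> R) (a v : 'rV[R]_n) (h : R) :
  differentiable f (a + h *: v) ->
  is_derive h 1 (fun k : R => f (a + k *: v)) (derive f (a + h *: v) v).
Proof.
move=> df; have dv : derivable f (a + h *: v) v by exact: diff_derivable.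
have e : (fun k : R => k^-1 *: (((fun k : R => f (a + k *: v)) \o shift h) (k *: 1) - f (a + h *: v))) =
    (fun k : R => k^-1 *: ((f \o shift (a + h *: v)) (k *: v) - f (a + h *: v))).
  apply/funext => k /=; congr (_ *: (f _ - _)).
  by rewrite scaler1 scalerDl [RHS]addrCA.
by split; rewrite /derivable /derive e.
Qed.

Lemma derive_sum_partial n (f : 'rV[R]_n -> R) (a v : 'rV[R]_n) :
  differentiable f a -> derive f a v = \sum_i v 0 i * partial i f a.
Proof.
move=> df; rewrite deriveE// [in LHS](row_sum_delta v) linear_sum.
by apply: eq_bigr => i _; rewrite linearZ /partial deriveE.
Qed.

Lemma is_derive_linear_bound (f : R -> R) (l e : R) : is_derive (0 : R) 1 f l -> 0 < e ->
  exists2 del, 0 < del & forall k, `|k| < del -> `|f k - f 0 - l * k| <= e * `|k|.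
Proof.
move=> [df dl] e0; rewrite /derivable in df.
have /cvgrPdist_le/(_ _ e0) : (fun h : R => h^-1 *: ((f \o shift 0) (h *: 1) - f 0)) @ 0^' --> l.
  by rewrite -dl; exact: df.
move=> /nbhs_ballP[del /= d0 H]; exists del => // k kd.
have [->|k0] := eqVneq k 0; first by rewrite mulr0 normr0 mulr0 subrr subr0 normr0.
have : `|l - k^-1 *: ((f \o shift 0) (k *: 1) - f 0)| <= e.
  by apply: H => //; rewrite /ball /= sub0r normrN.
rewrite /= scaler1 addr0 => h.
have -> : f k - f 0 - l * k = - ((l - k^-1 *: (f k - f 0)) * k).
  by rewrite /GRing.scale /=; field.
by rewrite normrN normrM ler_wpM2r.
Qed.

(** With [c = H - e], the function [F k = g (k v) + g (- k v) - c k^2] vanishes at 0 and has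
    derivative [chi k - chi (- k) - 2 c k]. Differentiability of [chi] at 0 alone makes this
    nonnegative for small positive [k], the value [chi 0] cancelling, so the mean value theorem
    gives [F >= 0]. Continuity of the second derivatives does not enter the argument. *)
Lemma second_order_lower m (g : 'rV[R]_m -> R) (v : 'rV[R]_m) (e : R) :
  (forall x, differentiable g x) -> (forall j, differentiable (partial j g) 0) ->
  g 0 = 0 -> 0 < e ->
  exists2 del, 0 < del & forall h, 0 < h < del ->
   (\sum_j v 0 j * (\sum_k v 0 k * partial k (partial j g) 0) - e) * h ^+ 2
    <= g (h *: v) + g (- h *: v).
Proof.
move=> dg dpg g0 e0; set H := \sum_j _.
pose chi (h : R) := \sum_j v 0 j * partial j g (h *: v).
have dchi : is_derive (0 : R) 1 chi H.
  have -> : chi = \sum_j (fun h : R => v 0 j *: partial j g (h *: v)).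
    by apply/funext => h; rewrite fct_sumE.
  apply: is_derive_sum => j.
  have : is_derive (0 : R) 1 (fun h : R => partial j g (0 + h *: v)) (derive (partial j g) (0 + 0 *: v) v).
    by apply: is_derive_line; rewrite scale0r addr0.
  rewrite scale0r addr0 derive_sum_partial// => h.
  have -> : (fun h0 : R => v 0 j *: partial j g (h0 *: v)) =
    v 0 j \*: (fun h : R => partial j g (0 + h *: v)).
    by apply/funext => k /=; rewrite add0r.
  exact: is_deriveZ.
have dpsi (h : R) : is_derive h 1 (fun h : R => g (h *: v)) (chi h).
  have := @is_derive_line _ g 0 v h (dg _).
  rewrite derive_sum_partial// add0r; rewrite (_ : (fun k : R => g (0 + k *: v)) = (fun h : R => g (h *: v)))//.
  by apply/funext => k; rewrite add0r.
have [del del0 Hdel] := is_derive_linear_bound dchi e0.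
exists del => // h /andP[h0 hdel].
pose c := H - e.
pose F (k : R) := g (k *: v) + g (- k *: v) - c * k ^+ 2.
have dF (k : R) : is_derive k 1 F (chi k - chi (- k) - c * (k *+ 2)).
  have d2 : is_derive k 1 (fun k : R => g (- k *: v)) (- chi (- k)).
    have := @is_derive1_comp _ (fun h : R => g (h *: v)) (@GRing.opp R) k _ _ (dpsi (- k)) (is_deriveN _).
    by move=> /(_ 1 (is_derive_id _ _)); rewrite mulrN1.
  have -> : F = (fun k : R => g (k *: v)) + (fun k : R => g (- k *: v))
      - c *: (@id R ^+ 2).
    by apply/funext => z; rewrite /F !fctE.
  have d3 := is_deriveZ c (is_deriveX 2 (is_derive_id k (1 : R))).
  apply: (is_derive_eq (is_deriveB (is_deriveD (dpsi k) d2) d3)).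
  by rewrite /GRing.scale /= expr1 mulr1 mulr_natl.
have cF : {within `[0, h], continuous F}.
  apply: continuous_subspaceT => k; apply: differentiable_continuous.
  by apply/derivable1_diffP; case: (dF k).
have [xi /andP[]] := MVT h0 (fun k _ => dF k) cF.
rewrite !bnd_simp => xi0 xih; rewrite /F oppr0 !scale0r g0 expr0n /= mulr0 addr0 !subr0 => E.
rewrite -subr_ge0 E mulr_ge0//; last by rewrite addr0 ltW.
have := Hdel xi; have := Hdel (- xi); rewrite normrN gtr0_norm// (lt_trans xih hdel).
move=> /(_ isT); rewrite ler_norml => /andP[_ A1] /(_ isT); rewrite ler_norml => /andP[A2 _].
by rewrite /c; move: A1 A2; lra.
Qed.
End Calculus.

Lemma ler_sqr_ge0 (R : realType) (a b : R) : 0 <= a -> a <= b -> a ^+ 2 <= b ^+ 2.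
Proof. by move=> a0 ab; rewrite lerXn2r// nnegrE// (le_trans a0). Qed.

(** * Chart coordinates and tangency at a nearest boundary point *)

Section Chart.
Variables (R : realType) (m : nat).
Local Notation n := m.+1.
Local Notation jn := (@join R m.+1).

Lemma join_widen (x : 'rV[R]_m) t (i : 'I_m) :
  (jn x t) 0 (widen_ord (leqnSn m) i) = x 0 i.
Proof.
rewrite mxE /=; case: insubP => [u _ ui|]; last by rewrite ltn_ord.
by rewrite /=; congr (x _ _); apply/val_inj.
Qed.

Lemma join_max (x : 'rV[R]_m) t : (jn x t) 0 ord_max = t.
Proof. by rewrite mxE /=; case: insubP => //= u; rewrite ltnn. Qed.

Lemma ord_split (P : 'I_n -> Prop) :
  (forall i : 'I_m, P (widen_ord (leqnSn m) i)) -> P ord_max -> forall i, P i.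
Proof.
move=> Pw Pm i; have [im|mi] := ltnP i m.
  by rewrite (_ : i = widen_ord (leqnSn m) (Ordinal im))//; apply/val_inj.
rewrite (_ : i = ord_max)//; apply/val_inj => /=; apply/eqP.
by rewrite eqn_leq mi andbT -ltnS.
Qed.

Lemma join_lin a (x y : 'rV[R]_m) t u :
  jn (a *: x + y) (a * t + u) = a *: jn x t + jn y u.
Proof.
have e k : (a *: jn x t + jn y u) 0 k = a * jn x t 0 k + jn y u 0 k.
  by rewrite [LHS]mxE; congr (_ + _); rewrite [LHS]mxE.
apply/rowP; apply: ord_split => [i|]; rewrite e; first by rewrite !join_widen !mxE.
by rewrite !join_max.
Qed.

Lemma joinB (x y : 'rV[R]_m) t u : jn (x - y) (t - u) = jn x t - jn y u.
Proof.
have := join_lin (-1) y x u t.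
by rewrite !scaleN1r mulN1r [- y + x]addrC [- u + t]addrC [in RHS]addrC.
Qed.

Lemma join_eta (z : 'rV[R]_n) : z = jn (\row_i z 0 (widen_ord (leqnSn m) i)) (z 0 ord_max).
Proof.
by apply/rowP; apply: ord_split => [i|]; rewrite ?join_max// join_widen mxE.
Qed.

Lemma enorm_join (x : 'rV[R]_m) t : enorm (jn x t) ^+ 2 = enorm x ^+ 2 + t ^+ 2.
Proof.
rewrite !enorm_sq big_ord_recr /= join_max; congr (_ + _).
by apply: eq_bigr => i _; rewrite join_widen.
Qed.

Lemma enorm_join_le (x : 'rV[R]_m) t : enorm (jn x t) <= enorm x + `|t|.
Proof.
rewrite -(@ler_pXn2r _ 2)// ?nnegrE ?addr_ge0 ?enorm_ge0// enorm_join sqrrD.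
by rewrite real_normK ?num_real// addrAC lerDl mulrn_wge0// mulr_ge0 ?enorm_ge0.
Qed.

Lemma enorm_mul_orth (x : 'rV[R]_n) (Q : 'M[R]_n) : Q *m Q^T = 1%:M -> enorm (x *m Q) = enorm x.
Proof.
move=> QQ; have h (z : 'rV[R]_n) : \sum_i z 0 i ^+ 2 = (z *m z^T) 0 0.
  by rewrite mxE; apply: eq_bigr => i _; rewrite mxE expr2.
by rewrite /enorm !h trmx_mul mulmxA -[x *m Q *m _]mulmxA QQ mulmx1.
Qed.

Variables (Om : set 'rV[R]_n).
Hypotheses (oOm : open Om) (Om0 : ~` Om !=set0).
Local Notation d := (dist_compl Om).

Section Barrier.
Variables (x y : 'rV[R]_n) (Q : 'M[R]_n) (rho : R) (g : 'rV[R]_m -> R).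
Hypotheses (xO : Om x) (yO : ~ Om y) (xy : enorm (x - y) = d x).
Hypothesis chart : @bdry_chart R n Om y Q rho g.

Lemma chart_out h t : enorm (jn h t) < rho -> t <= g h -> ~ Om (y + jn h t *m Q).
Proof. by case: chart => _ _ _ _ H ht tg /(H h t ht); rewrite ltNge tg. Qed.

(** Every point on or below the graph is outside [Om] and so bounds [d] from above; orthogonality of
    [Q] lets the distance be computed in chart coordinates. *)
Lemma chart_dist_le (w : 'rV[R]_n) h t : enorm (jn h t) < rho -> t <= g h ->
  d (y + w *m Q) <= enorm (w - jn h t).
Proof.
move=> ht tg; have [QQ _ _ _ _] := chart.
apply: (le_trans (dist_le _ (chart_out ht tg))).
by rewrite opprD addrACA subrr add0r -mulmxBl enorm_mul_orth.
Qed.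

(** The gradient of [g] vanishes at 0, so [g] is [o(h)] along every line through 0. *)
Lemma chart_small (v : 'rV[R]_m) e : 0 < e -> exists2 del, 0 < del &
  forall h, `|h| < del -> `|g (h *: v)| <= e * `|h|.
Proof.
move=> e0; have [_ _ [dg _] [g0 pg0] _] := chart.
have : is_derive (0 : R) 1 (fun h : R => g (0 + h *: v)) (derive g (0 + 0 *: v) v).
  exact: is_derive_line.
rewrite scale0r addr0 derive_sum_partial// big1 => [|i _]; last by rewrite pg0 mulr0.
move=> /is_derive_linear_bound/(_ e0)[del d0 H]; exists del => // h /H.
by rewrite scale0r !addr0 add0r g0 mul0r !subr0.
Qed.

(* The open ball of radius [d x] about [x] lies in [Om] and has [y] on its
   boundary, so it must be tangent to the graph of [g] at [y]. *)
Lemma nearest_normal : x - y = jn 0 (d x) *m Q.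
Proof.
have d0 := dist_gt0 oOm Om0 xO.
have [QQ rho0 _ [g0 _] _] := chart.
have QtQ : Q^T *m Q = 1%:M by exact: mulmx1C.
set w := (x - y) *m Q^T; have wE : x - y = w *m Q by rewrite -mulmxA QtQ mulmx1.
have xE : x = y + w *m Q by rewrite -wE addrC subrK.
have wd : enorm w = d x by rewrite -xy wE enorm_mul_orth.
have [b [t wj]] : exists b t, w = jn b t by eexists; eexists; exact: join_eta.
have dsq : d x ^+ 2 = enorm b ^+ 2 + t ^+ 2 by rewrite -wd wj enorm_join.
(* If the horizontal part [b] were nonzero, the graph point over [eta b] would be closer to [x] than
   [d x]: moving towards [b] lowers the squared distance at first order in [eta], while the height
   [G] of the graph is [o(eta)]. *)
have b0 : enorm b = 0.
  apply/eqP; rewrite eq_le enorm_ge0 andbT leNgt; apply/negP => be.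
  pose beta := enorm b ^+ 2; have beta0 : 0 < beta by rewrite exprn_gt0.
  (* Chosen so that the total error [e (2 |t| + 1)] is at most [beta / 2], against a gain of at
     least [3 / 2 * beta]. *)
  pose e := Num.min 1 (beta / (2 * (2 * `|t| + 1))).
  have K0 : 0 < 2 * (2 * `|t| + 1) by have := normr_ge0 t; lra.
  have e0 : 0 < e by rewrite lt_min ltr01 divr_gt0.
  have e1 : e <= 1 by rewrite ge_min lexx.
  have eb : e * (2 * `|t| + 1) * 2 <= beta.
    have : e <= beta / (2 * (2 * `|t| + 1)) by rewrite ge_min lexx orbT.
    by rewrite ler_pdivlMr// => h; rewrite -mulrA [_ * 2]mulrC.
  have [del del0 Hdel] := chart_small b e0.
  have B0 : 0 < 2 * (enorm b + 1) by lra.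
  (* The three bounds serve the smallness of [g], the estimate [2 - eta >= 3 / 2], and membership of
     the graph point in the chart ball. *)
  pose eta := Num.min (Num.min (del / 2) (1 / 2)) (rho / (2 * (enorm b + 1))).
  have eta0 : 0 < eta by rewrite !lt_min !divr_gt0.
  have etad : eta < del.
    have : eta <= del / 2 by rewrite !ge_min lexx.
    by move=> h; move: del0; lra.
  have eta2 : eta <= 1 / 2 by rewrite !ge_min lexx orbT.
  have etar : eta * (enorm b + 1) * 2 <= rho.
    have : eta <= rho / (2 * (enorm b + 1)) by rewrite ge_min lexx orbT.
    by rewrite ler_pdivlMr// => h; rewrite -mulrA [_ * 2]mulrC.
  have gs : `|g (eta *: b)| <= e * eta.
    by have := Hdel eta; rewrite (gtr0_norm eta0) => /(_ etad).
  set G := g (eta *: b) in gs.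
  have je : enorm (jn (eta *: b) G) < rho.
    rewrite (le_lt_trans (enorm_join_le _ _))// enormZ gtr0_norm//.
    have : e * eta <= eta by rewrite ler_piMl// ltW.
    have : 0 < eta * (enorm b + 1) by rewrite mulr_gt0//; lra.
    by move: gs etar; rewrite mulrDr mulr1; lra.
  have := chart_dist_le w je (lexx _); rewrite -xE wj -joinB.
  move=> /(ler_sqr_ge0 (ltW d0)); rewrite dsq enorm_join.
  have -> : b - eta *: b = (1 - eta) *: b by rewrite scalerBl scale1r.
  rewrite enormZ exprMn real_normK ?num_real// -/beta => key.
  have tG : - (t * G) <= `|t| * (e * eta).
    by rewrite (le_trans (ler_norm _))// normrN normrM ler_wpM2l.
  have G2 : G ^+ 2 <= e * eta * eta.
    rewrite -[G ^+ 2]real_normK ?num_real//.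
    have h1 : `|G| <= eta by rewrite (le_trans gs)// ler_piMl// ltW.
    by rewrite expr2 ler_pM.
  have : eta * ((2 - eta) * beta) <= eta * (2 * `|t| * e + e * eta).
    have : (1 - eta) ^+ 2 * beta = beta - eta * ((2 - eta) * beta) by ring.
    have : (t - G) ^+ 2 = t ^+ 2 - t * G *+ 2 + G ^+ 2 by ring.
    have -> : eta * (2 * `|t| * e + e * eta) = (`|t| * (e * eta)) *+ 2 + e * eta * eta by ring.
    by move: key tG G2; lra.
  rewrite ler_pM2l// => fin1.
  have h1 : 3 / 2 * beta <= (2 - eta) * beta by apply: (ler_wpM2r (ltW beta0)); move: eta2; lra.
  have h2 : e * eta <= e by apply: (ler_piMr (ltW e0)); move: eta2; lra.
  have : e * (2 * `|t| + 1) = 2 * `|t| * e + e by ring.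
  by move: fin1 h1 h2 eb beta0; lra.
have t2 : t ^+ 2 = d x ^+ 2 by rewrite dsq b0 expr0n add0r.
(* If [t = - d x], the point at height [- eta] below [y] is outside [Om] yet at distance [d x - eta]
   from [x]. *)
have td : t = d x.
  move/eqP: t2; rewrite eqf_sqr => /orP[/eqP//|/eqP tN].
  pose eta := Num.min rho (d x) / 2.
  have eta0 : 0 < eta by rewrite divr_gt0// lt_min rho0.
  have er : eta < rho.
    by rewrite /eta ltr_pdivrMr// gt_min; apply/orP; left; move: rho0; lra.
  have ed : eta < d x.
    by rewrite /eta ltr_pdivrMr// gt_min; apply/orP; right; move: d0; lra.
  clearbody eta.
  have je : enorm (jn 0 (- eta)) < rho.
    rewrite (le_lt_trans (enorm_join_le _ _))// normrN gtr0_norm//.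
    by rewrite enorm0 add0r.
  have ge : - eta <= g 0 by rewrite g0 oppr_le0 ltW.
  have := chart_dist_le w je ge; rewrite -xE wj -joinB.
  move=> /(ler_sqr_ge0 (ltW d0)); rewrite enorm_join subr0 b0 expr0n /= add0r tN.
  have -> : (- d x - - eta) ^+ 2 = d x ^+ 2 - eta * (2 * d x - eta) by ring.
  have : 0 < eta * (2 * d x - eta) by rewrite mulr_gt0//; move: ed eta0; lra.
  lra.
by rewrite wE wj td (enorm_eq0 b0).
Qed.

End Barrier. End Chart.

Lemma exists_common_delta (R : realType) (I : finType) (P : I -> R -> Prop) :
  (forall i, exists2 del, 0 < del & forall h, 0 < h < del -> P i h) ->
  exists2 del, 0 < del & forall h, 0 < h < del -> forall i, P i h.
Proof.
move=> H; have /choice[D HD] : forall i, exists del : R, 0 < del /\ forall h, 0 < h < del -> P i h.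
  by move=> i; have [del] := H i; exists del.
exists (\big[Num.min/1]_i D i).
  by apply: lt_bigmin => // i _; exact: (HD i).1.
move=> h /andP[h0 hd] i; apply: (HD i).2; rewrite h0 (lt_le_trans hd)//.
exact: bigmin_le_cond.
Qed.

(** * Second differences of the distance in the frame of a chart *)

Section SecondDiff.
Variables (R : realType) (m : nat).
Local Notation n := m.+1.
Local Notation jn := (@join R m.+1).
Variables (Om : set 'rV[R]_n).
Hypotheses (oOm : open Om) (Om0 : ~` Om !=set0).
Local Notation d := (dist_compl Om).
Variables (x y : 'rV[R]_n) (Q : 'M[R]_n) (rho : R) (g : 'rV[R]_m -> R).
Hypotheses (xO : Om x) (yO : ~ Om y) (xy : enorm (x - y) = d x).
Hypothesis chart : @bdry_chart R n Om y Q rho g.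
Local Notation wid := (widen_ord (leqnSn m)).

Lemma chart_barrier (q : 'rV[R]_m) r : exists2 del, 0 < del & forall h, `|h| < del ->
  d (x + h *: (jn q r *m Q)) <= d x + h * r - g (h *: q).
Proof.
have d0 := dist_gt0 oOm Om0 xO.
have [_ rho0 _ _ _] := chart.
have [del del0 Hdel] := chart_small chart q (@ltr01 R).
have A0 : 0 < enorm q + 1 by have := enorm_ge0 q; lra.
have B0 : 0 < `|r| + 1 by have := normr_ge0 r; lra.
(* The thresholds ensure, in turn, that [|g (h q)| <= |h|], that the graph point lies in the chart
   ball, and that the vertical gap [d x + h r - g (h q)] is nonnegative, hence equal to the distance
   without absolute value. *)
exists (Num.min del (Num.min (rho / (enorm q + 1)) (d x / (`|r| + 1)))).
  by rewrite !lt_min del0 !divr_gt0.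
move=> h; rewrite !lt_min => /and3P[/Hdel]; rewrite mul1r => gh.
rewrite !ltr_pdivlMr// => h1 h2.
have hs : enorm (jn (h *: q) (g (h *: q))) < rho.
  rewrite (le_lt_trans (enorm_join_le _ _))// enormZ (le_lt_trans _ h1)//.
  by rewrite mulrDr mulr1 lerD2l.
have := chart_dist_le chart (jn 0 (d x) + h *: jn q r) hs (lexx _).
have -> : y + (jn 0 (d x) + h *: jn q r) *m Q = x + h *: (jn q r *m Q).
  rewrite mulmxDl -scalemxAl addrA; congr (_ + _).
  by rewrite -(nearest_normal oOm Om0 xO xy chart) addrC subrK.
move=> H; apply: (le_trans H).
have -> : jn 0 (d x) + h *: jn q r - jn (h *: q) (g (h *: q)) = jn 0 (d x + h * r - g (h *: q)).
  by rewrite [jn 0 _ + _]addrC -join_lin -joinB addr0 subrr [h * r + _]addrC.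
have pos : 0 <= d x + h * r - g (h *: q).
  have : - (h * r) <= `|h| * `|r| by rewrite -normrM -normrN ler_norm.
  have := ler_norm (g (h *: q)); move: gh h2; rewrite mulrDr mulr1; lra.
rewrite -(@ler_pXn2r _ 2)// ?nnegrE ?enorm_ge0// enorm_join.
by rewrite enorm0 expr0n add0r.
Qed.

(** A coordinate vector has the entries of column [i] of [Q] as its coordinates in the orthonormal
    frame given by the rows of [Q]. *)
Lemma delta_frame i : delta_mx 0 i =
  jn (\row_j Q (wid j) i) (Q ord_max i) *m Q :> 'rV[R]_n.
Proof.
have [QQ _ _ _ _] := chart; have QtQ : Q^T *m Q = 1%:M by exact: mulmx1C.
rewrite -[LHS]mulmx1 -QtQ mulmxA; congr (_ *m _).
rewrite -rowE; apply/rowP; apply: ord_split => [j|].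
  by rewrite join_widen !mxE.
by rewrite join_max !mxE.
Qed.

(** Invariance of the trace. The first [m] rows of [Q] are orthonormal, so the horizontal parts
    [q_i] of the [n] coordinate vectors satisfy [sum_i q_i^T q_i = 1] in dimension [m], although
    there is one more of them than the dimension. *)
Lemma trace_frame (D : 'I_m -> 'I_m -> R) :
  \sum_(i < n) \sum_j Q (wid j) i * (\sum_k Q (wid k) i * D k j) = \sum_j D j j.
Proof.
have [QQ _ _ _ _] := chart.
rewrite exchange_big /=; apply: eq_bigr => j _.
under eq_bigr do rewrite mulr_sumr.
rewrite exchange_big /=.
rewrite (bigD1 j)//= [X in _ + X]big1 ?addr0 => [|k kj].
  under eq_bigr do rewrite mulrA.
  rewrite -mulr_suml; have /matrixP/(_ (wid j) (wid j)) := QQ.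
  rewrite !mxE eqxx => E; rewrite (_ : \sum_i _ = 1) ?mul1r//.
  by rewrite -[RHS]E; apply: eq_bigr => i _; rewrite mxE.
under eq_bigr do rewrite mulrA.
rewrite -mulr_suml; have /matrixP/(_ (wid j) (wid k)) := QQ.
rewrite !mxE (_ : (_ == _) = false) => [E|]; last first.
  by apply/negbTE; apply: contraNneq kj => /(congr1 val)/= e; apply/eqP/val_inj.
rewrite (_ : \sum_i _ = 0) ?mul0r//.
by rewrite -[RHS]E; apply: eq_bigr => i _; rewrite mxE.
Qed.

(** Adding the barriers for [h] and [- h] cancels the vertical displacements and leaves minus a
    symmetric second difference of [g] along the horizontal part of each coordinate vector. Each of
    the [n] directions is allowed an error [e / n]. *)
Lemma dist_second_diff e : 0 < e -> exists2 del, 0 < del & forall h, 0 < h < del ->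
  \sum_i (d (x + h *: delta_mx 0 i) + d (x - h *: delta_mx 0 i) - d x *+ 2) <=
  (e - \sum_j partial j (partial j g) 0) * h ^+ 2.
Proof.
move=> e0; have [_ _ [dg dpg] [g0 _] _] := chart.
have en0 : 0 < e / n%:R by rewrite divr_gt0.
pose q i := \row_j Q (wid j) i.
have step i : exists2 del, 0 < del & forall h, 0 < h < del ->
    d (x + h *: delta_mx 0 i) + d (x - h *: delta_mx 0 i) - d x *+ 2 <=
    (e / n%:R - \sum_j Q (wid j) i * (\sum_k Q (wid k) i * partial k (partial j g) 0)) * h ^+ 2.
  have [d1 d10 H1] := chart_barrier (q i) (Q ord_max i).
  have [d2 d20 H2] := second_order_lower (q i) dg (fun j => (dpg j).1 0) g0 en0.
  exists (Num.min d1 d2); first by rewrite lt_min d10.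
  move=> h /andP[h0]; rewrite lt_min => /andP[hd1 hd2].
  have := H2 h; rewrite h0 hd2 => /(_ isT).
  rewrite (_ : \sum_j _ = \sum_j Q (wid j) i * (\sum_k Q (wid k) i * partial k (partial j g) 0)); last first.
    apply: eq_bigr => j _; rewrite mxE; congr (_ * _).
    by apply: eq_bigr => k _; rewrite mxE.
  set S := \sum_j _ => B0.
  have B1 : d (x + h *: delta_mx 0 i) <= d x + h * Q ord_max i - g (h *: q i).
    by rewrite delta_frame; apply: H1; rewrite gtr0_norm.
  have B2 : d (x - h *: delta_mx 0 i) <= d x - h * Q ord_max i - g (- h *: q i).
    by rewrite delta_frame -scaleNr -mulNr; apply: H1; rewrite normrN gtr0_norm.
  have -> : (e / n%:R - S) * h ^+ 2 = - ((S - e / n%:R) * h ^+ 2) by ring.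
  have aux (a b t u G1 G2 C : R) :
    C <= G1 + G2 -> a <= t + u - G1 -> b <= t - u - G2 -> a + b - t *+ 2 <= - C by lra.
  exact: aux B0 B1 B2.
have [del del0 Hdel] := exists_common_delta step.
exists del => // h hd.
apply: (le_trans (ler_sum _ (fun i _ => Hdel h hd i))).
rewrite -mulr_suml sumrB trace_frame sumr_const card_ord -[e / _ *+ _]mulr_natr divfK ?pnatr_eq0//.
Qed.

End SecondDiff.

(** * Real powers and linearity of the iterated integral *)

Section PowR.
Variable R : realType.
Implicit Types s a b h x y : R.

Lemma powR_anti s x y : 0 <= s -> 0 < x -> x <= y -> y `^ (- s) <= x `^ (- s).
Proof.
move=> s0 x0 xy; have y0 := lt_le_trans x0 xy.
by rewrite !powRN lef_pV2 ?posrE ?powR_gt0// ge0_ler_powR// nnegrE ltW.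
Qed.

Lemma powR_mvt s x y : 0 < x -> x < y -> exists2 c : R, x < c < y &
  y `^ (1 - s) - x `^ (1 - s) = (1 - s) * c `^ (- s) * (y - x).
Proof.
move=> x0 xy.
have dP (c : R) : 0 < c -> is_derive c 1 (@powR R ^~ (1 - s)) ((1 - s) * c `^ (- s)).
  by move=> c0; have := is_derive1_powR (1 - s) c0; rewrite addrAC subrr add0r.
have dI (c : R) : c \in `]x, y[ -> is_derive c 1 (@powR R ^~ (1 - s)) ((1 - s) * c `^ (- s)).
  by rewrite in_itv/= => /andP[xc _]; apply: dP; exact: lt_trans xc.
have cI : {within `[x, y], continuous (@powR R ^~ (1 - s))}.
  apply: continuous_in_subspaceT => c; rewrite inE/= in_itv/= => /andP[xc _].
  apply: differentiable_continuous; apply/derivable1_diffP.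
  by case: (dP c (lt_le_trans x0 xc)).
have [c] := MVT xy dI cI.
by rewrite in_itv/= => cxy E; exists c.
Qed.

(** The mean value point is at most [a + h], and [t^(-s)] decreases. Evaluating at [a + h] makes the
    bound the same for all coordinate directions. *)
Lemma powR_slope s a b h : 1 <= s -> 0 < a -> 0 < b -> `|b - a| <= h ->
  (b `^ (1 - s) - a `^ (1 - s)) * (b - a) <= - ((s - 1) * (a + h) `^ (- s) * (b - a) ^+ 2).
Proof.
move=> s1 a0 b0 bah.
have s10 : 0 <= s - 1 by rewrite subr_ge0.
suff [c [c0 ch E]] : exists c : R, [/\ 0 < c, c <= a + h &
    b `^ (1 - s) - a `^ (1 - s) = (1 - s) * c `^ (- s) * (b - a)].
  have hc : (a + h) `^ (- s) <= c `^ (- s) by apply: powR_anti => //; lra.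
  rewrite E; move: hc; set p := c `^ _; set q := (a + h) `^ _ => hc.
  have -> : (1 - s) * p * (b - a) * (b - a) = - ((s - 1) * p * (b - a) ^+ 2) by ring.
  by rewrite lerN2 ler_wpM2r ?sqr_ge0// ler_wpM2l.
move: bah; rewrite ler_norml => /andP[h1 h2].
have [ab|ba|->] := ltgtP a b.
- have [c /andP[ac cb] E] := powR_mvt s a0 ab.
  by exists c; split => //; [exact: lt_trans ac|lra].
- have [c /andP[ac cb] E] := powR_mvt s b0 ba.
  exists c; split; [exact: lt_trans ac|lra|].
  by rewrite -opprB E -mulrN opprB.
by exists b; rewrite !subrr mulr0; split => //; lra.
Qed.

Lemma continuous_fun_powR (T : topologicalType) (f : T -> R) r :
  continuous f -> (forall t, 0 < f t) -> continuous (fun t => f t `^ r).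
Proof.
move=> cf f0 x; apply: (@continuous_comp _ _ _ f (@powR R ^~ r)); first exact: cf.
apply: differentiable_continuous; apply/derivable1_diffP.
by case: (is_derive1_powR r (f0 x)).
Qed.

Lemma continuous_fun_sqrt (T : topologicalType) (f : T -> R) :
  continuous f -> continuous (fun t => Num.sqrt (f t)).
Proof.
by move=> cf x; apply: (@continuous_comp _ _ _ f Num.sqrt); [exact: cf|exact: sqrt_continuous].
Qed.

End PowR.

Section IntMore.
Variables (R : realType) (n : nat) (A : R).
Hypothesis A0 : 0 <= A.
Implicit Types f g : 'rV[R]_n -> R.

Lemma cc_le B f : A <= B -> cc A f -> cc B f.
Proof. by move=> AB [cf sf]; split => // x Bx; apply: sf; exact: le_lt_trans Bx. Qed.

Lemma cc_mul f g : cc A f -> continuous g -> cc A (fun x => f x * g x).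
Proof. by move=> [cf sf] cg; split => [|x /sf ->]; [exact: continuous_funM|rewrite mul0r]. Qed.

Lemma ccD f g : cc A f -> cc A g -> cc A (fun x => f x + g x).
Proof. by move=> cf cg; have := cc_lin 1 cf cg; under eq_fun do rewrite mul1r. Qed.

Lemma ccZ a f : cc A f -> cc A (fun x => a * f x).
Proof. by move=> cf; have := cc_lin a cf (cc0 _ _); under eq_fun do rewrite addr0. Qed.

Lemma ccB f g : cc A f -> cc A g -> cc A (fun x => f x - g x).
Proof.
by move=> cf cg; have := cc_lin (-1) cg cf; under eq_fun do rewrite mulN1r addrC.
Qed.

Lemma cc_sum (I : finType) (F : I -> 'rV[R]_n -> R) : (forall i, cc A (F i)) ->
  cc A (fun x => \sum_i F i x).
Proof.
move=> cF; split => [|x xA]; first by apply: continuous_fun_sum => i; exact: (cF i).1.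
by rewrite big1 // => i _; exact: (cF i).2.
Qed.

Lemma Int0 : Int (fun _ : 'rV[R]_n => 0 : R) = 0.
Proof.
have := Int_lin A0 (-1) (cc0 n A) (cc0 n A); rewrite mulN1r addNr => H.
apply: (eq_trans _ H); congr (@Int R n); apply/funext => x.
by rewrite mulr0 addr0.
Qed.

Lemma IntZ a f : cc A f -> Int (fun x => a * f x) = a * Int f.
Proof.
move=> cf; have := Int_lin A0 a cf (cc0 n A); rewrite [X in _ + X]Int0 addr0 => <-.
by congr (@Int R n); apply/funext => x; rewrite addr0.
Qed.

Lemma IntD f g : cc A f -> cc A g -> Int (fun x => f x + g x) = Int f + Int g.
Proof.
move=> cf cg; have := Int_lin A0 1 cf cg; rewrite mul1r => <-.
by congr (@Int R n); apply/funext => x; rewrite mul1r.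
Qed.

Lemma IntB f g : cc A f -> cc A g -> Int (fun x => f x - g x) = Int f - Int g.
Proof.
move=> cf cg; have := Int_lin A0 (-1) cg cf; rewrite mulN1r addrC => <-.
by congr (@Int R n); apply/funext => x; rewrite mulN1r addrC.
Qed.

Lemma Int_sum (I : finType) (F : I -> 'rV[R]_n -> R) : (forall i, cc A (F i)) ->
  Int (fun x => \sum_i F i x) = \sum_i Int (F i).
Proof.
move=> cF; suff [] : cc A (fun x => \sum_i F i x) /\
  Int (fun x => \sum_i F i x) = \sum_i Int (F i) by [].
rewrite (_ : (fun x => \sum_i F i x) = \sum_i F i); last first.
  by apply/funext => x; rewrite fct_sumE.
elim/big_ind2 : _ => [|f a g b [cf <-] [cg <-]|i _]; last by split.
  by split; [exact: cc0|exact: Int0].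
by split; [exact: ccD|rewrite -IntD].
Qed.

Lemma Int_cvg0 (f_ : nat -> 'rV[R]_n -> R) M : (forall j, cc A (f_ j)) ->
  (forall j x, `|f_ j x| <= M) -> (forall x, f_ j x @[j --> \oo] --> (0 : R)) ->
  Int (f_ j) @[j --> \oo] --> (0 : R).
Proof.
move=> cf fM f0; rewrite -Int0.
by apply: (Int_dominated A0 cf (cc0 n A) fM).
Qed.

End IntMore.

(** * The weighted gradient inequality *)

Lemma continuous_line (R : realType) n (f : 'rV[R]_n -> R) (x v : 'rV[R]_n) :
  continuous f -> continuous (fun k : R => f (x + k *: v)).
Proof.
move=> cf k; apply: (@continuous_comp _ _ _ (fun k : R => x + k *: v) f); last exact: cf.
by apply: cvgD; [exact: cvg_cst|exact: scalel_continuous].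
Qed.

Section MainInequality.
Variables (R : realType) (n : nat) (d u : 'rV[R]_n -> R) (G : 'I_n -> 'rV[R]_n -> R).
Variables (s lam de A L : R).
Hypotheses (A0 : 0 <= A) (de0 : 0 < de) (s1 : 1 <= s).
Hypothesis dlip : forall x v, `|d (x + v) - d x| <= enorm v.
Hypothesis cd : continuous d.
Hypothesis dnu : forall x, de <= d x -> exists2 nu : 'rV[R]_n, \sum_i nu 0 i ^+ 2 = 1 &
  forall v, d (x + v) <= d x + \sum_i nu 0 i * v 0 i + enorm v ^+ 2 / (2 * de).
Hypothesis dsec : forall x, u x != 0 -> forall e : R, 0 < e ->
  exists2 del : R, 0 < del & forall h, 0 < h < del ->
  \sum_i (d (x + h *: delta_mx 0 i) + d (x - h *: delta_mx 0 i) - d x *+ 2) <=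
  (e - lam) * h ^+ 2.
Hypotheses (cu : cc A u) (cG : forall i, cc A (G i)).
Hypothesis uG : forall i x (h : nat -> R), (forall j, h j != 0) ->
  h j @[j --> \oo] --> (0 : R) ->
  (u (x + h j *: delta_mx 0 i) - u x) / h j @[j --> \oo] --> G i x.
Hypothesis uL : forall i x h, `|u (x + h *: delta_mx 0 i) - u x| <= L * `|h|.
(** The factor 2 leaves room for a shift: one step of length at most [de] from a point with
    [u x != 0] stays where [d >= de]. *)
Hypothesis ud : forall x, u x != 0 -> de *+ 2 <= d x.

Local Notation sh h i := (h *: delta_mx 0 i : 'rV[R]_n).
Local Notation B := (A + 1).

(* [e] agrees with [d] on the support of [u] but is bounded away from 0, which
   makes the weights continuous everywhere. *)
Let e x := Num.max (d x) de.
Let p x := e x `^ (1 - s).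
Let w x := `|u x|.
Let phi x := w x * p x.
Let Dp h i x := (d (x + sh h i) - d x) / h.
Let Dm h i x := (d x - d (x - sh h i)) / h.
(* A nonnegative bound for the distance of [Dp h i x] to the [i]-th normal component. *)
Let Rr h i x := Dm h i x - Dp h i x + 3 * h / (2 * de).
(** The weight sits at the shifted point to fit the product rule [phi (x + v) - phi x = (w (x + v) -
    w x) p (x + v) + w x (p (x + v) - p x)]. *)
Let a h i x := `|u (x + sh h i) - u x| / h * p (x + sh h i).
Let Nn h x := Num.sqrt (\sum_i a h i x ^+ 2).
Let Lap h x := \sum_i (Dp h i x - Dm h i x) / h.
Let F h x := phi x * Num.max 0 (Lap h x + lam).
Let W h x := w x * (e x + h) `^ (- s).

(** Steps at most [de] use the margin in [ud]; steps at most 1 keep shifted supports in the cube of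
    half-side [A + 1]. *)
Let h0 : R := Num.min de 1.
Let hh (j : nat) : R := h0 / j.+1%:R.

Lemma max_step_gt0 : 0 < h0. Proof. by rewrite lt_min de0 ltr01. Qed.

Lemma step_bounds j : [/\ 0 < hh j, hh j <= de & hh j <= 1].
Proof.
have h00 := max_step_gt0.
have hj : hh j <= h0 by rewrite ler_pdivrMr// ler_peMr ?ler1n// ltW.
split; first by rewrite divr_gt0.
  by rewrite (le_trans hj)// ge_min lexx.
by rewrite (le_trans hj)// ge_min lexx orbT.
Qed.

Lemma step_cvg0 : hh j @[j --> \oo] --> (0 : R).
Proof.
rewrite -[X in _ --> X](mulr0 h0); apply: cvgM; first exact: cvg_cst.
exact: cvg_harmonic.
Qed.

Lemma step_near_lt del : 0 < del -> \forall j \near \oo, 0 < hh j < del.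
Proof.
move=> del0; have /cvgrPdist_lt/(_ _ del0) := step_cvg0.
apply: filterS => j; rewrite sub0r normrN; have [hj _ _] := step_bounds j.
by rewrite hj gtr0_norm.
Qed.

Lemma enorm_coord_shift h i : enorm (sh h i) = `|h|.
Proof. by rewrite enormZ enorm_delta mulr1. Qed.

Lemma radius_ge0 : 0 <= B. Proof. by rewrite addr_ge0. Qed.

Lemma radius_le : A <= B. Proof. by rewrite lerDl. Qed.

Lemma cc_coord_shift (f : 'rV[R]_n -> R) h i : cc A f -> `|h| <= 1 -> cc B (fun x => f (x + sh h i)).
Proof.
move=> cf h1; apply: cc_le (cc_shift (sh h i) cf); rewrite lerD2l.
by rewrite (le_trans (norm_le_enorm _))// enorm_coord_shift.
Qed.

Lemma coord_shift_cvg (f : 'rV[R]_n -> R) x i : continuous f -> f (x + sh (hh j) i) @[j --> \oo] --> f x.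
Proof.
move=> cf; have := @continuous_line _ _ f x (delta_mx 0 i) cf 0.
rewrite /continuous_at scale0r addr0 => H.
exact: (cvg_comp hh _ step_cvg0 H).
Qed.

Lemma trunc_dist_ge x : de <= e x. Proof. by rewrite le_max lexx orbT. Qed.
Lemma trunc_dist_gt0 x : 0 < e x. Proof. exact: lt_le_trans (trunc_dist_ge x). Qed.
Lemma continuous_trunc_dist : continuous e.
Proof. by apply: continuous_fun_max => //; exact: continuous_fun_cst. Qed.
Lemma continuous_weight : continuous p.
Proof. by apply: continuous_fun_powR; [exact: continuous_trunc_dist|exact: trunc_dist_gt0]. Qed.
Lemma weight_ge0 x : 0 <= p x. Proof. exact: powR_ge0. Qed.
Lemma weight_le x : p x <= de `^ (1 - s).
Proof.
by rewrite /p -opprB powR_anti ?subr_ge0// trunc_dist_ge.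
Qed.
Lemma cc_abs : cc A w.
Proof.
split; first by apply: continuous_fun_norm; exact: cu.1.
by move=> x /cu.2; rewrite /w => ->; rewrite normr0.
Qed.
Lemma cc_weighted : cc A phi. Proof. exact: cc_mul cc_abs continuous_weight. Qed.
Lemma continuous_fwd h i : continuous (Dp h i).
Proof.
apply: continuous_funM; last exact: continuous_fun_cst.
by apply: continuous_funB => //; exact: continuous_shift_fun.
Qed.
Lemma continuous_bwd h i : continuous (Dm h i).
Proof.
apply: continuous_funM; last exact: continuous_fun_cst.
by apply: continuous_funB => //; exact: continuous_shift_fun.
Qed.
Lemma continuous_gap h i : continuous (Rr h i).
Proof.
apply: continuous_funD; last exact: continuous_fun_cst.
by apply: continuous_funB; [exact: continuous_bwd|exact: continuous_fwd].
Qed.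
Lemma continuous_discrete_laplacian h : continuous (Lap h).
Proof.
apply: continuous_fun_sum => i; apply: continuous_funM; last exact: continuous_fun_cst.
by apply: continuous_funB; [exact: continuous_fwd|exact: continuous_bwd].
Qed.

Lemma fwd_le1 h i x : 0 < h -> `|Dp h i x| <= 1.
Proof.
move=> h1; rewrite normrM normfV (gtr0_norm h1) ler_pdivrMr// mul1r.
by rewrite (le_trans (dlip _ _))// enorm_coord_shift gtr0_norm.
Qed.

Lemma bwd_shift h i x : Dm h i (x + sh h i) = Dp h i x.
Proof. by rewrite /Dm /Dp addrK. Qed.

Lemma bwd_le1 h i x : 0 < h -> `|Dm h i x| <= 1.
Proof. by move=> h1; rewrite -[x](subrK (sh h i)) bwd_shift fwd_le1. Qed.

Lemma gap_le h i x : 0 < h -> h <= de -> `|Rr h i x| <= 4.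
Proof.
move=> h1 hd; rewrite /Rr (le_trans (ler_normD _ _))//.
have hb : `|3 * h / (2 * de)| <= 2.
  rewrite ger0_norm ?divr_ge0 ?mulr_ge0// ?(ltW h1) ?(ltW de0)//.
  by rewrite ler_pdivrMr ?mulr_gt0//; lra.
have := bwd_le1 i x h1; have := fwd_le1 i x h1; have := ler_normB (Dm h i x) (Dp h i x).
by move: hb; lra.
Qed.

(** With [c = h / (2 de)], superdifferentiability along [h] and [- h] gives [Dp <= nu + c] and
    [Dm >= nu - c]. Hence [nu - Dp <= Dm - Dp + c], and [Dp - nu <= c <= Dm - Dp + 3 c] because
    [Dm - Dp >= -2 c]; this is the origin of the 3. *)
Lemma fwd_near_normal h x : 0 < h -> de <= d x -> exists2 nu : 'I_n -> R,
  \sum_i nu i ^+ 2 = 1 & forall i, `|Dp h i x - nu i| <= Rr h i x.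
Proof.
move=> h1 dx; have [nu nu1 Hnu] := dnu dx.
exists (nu 0) => // i.
have nusum k : \sum_i0 nu 0 i0 * (sh k i) 0 i0 = nu 0 i * k.
  rewrite (bigD1 i)//= big1 => [|j ji]; first by rewrite addr0 !mxE !eqxx mulr1.
  by rewrite !mxE (negbTE ji) andbF !mulr0.
have E : h ^+ 2 / (2 * de) = h / (2 * de) * h by rewrite expr2 mulrAC.
have D1 : Dp h i x <= nu 0 i + h / (2 * de).
  rewrite ler_pdivrMr// mulrDl lerBlDl addrA.
  have := Hnu (sh h i); rewrite nusum enorm_coord_shift gtr0_norm// => H.
  by rewrite (le_trans H)// E.
have D2 : nu 0 i - h / (2 * de) <= Dm h i x.
  rewrite ler_pdivlMr// mulrBl.
  have := Hnu (sh (- h) i); rewrite nusum enorm_coord_shift normrN gtr0_norm// mulrN scaleNr => H.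
  by move: H; rewrite E; lra.
have E' : Rr h i x = Dm h i x - Dp h i x + (h / (2 * de)) *+ 3.
  by rewrite /Rr -mulrA mulr_natl.
have C0 : 0 <= h / (2 * de) by rewrite divr_ge0 ?mulr_ge0// ltW.
have aux (x1 x2 y1 c : R) : 0 <= c -> x1 <= y1 + c -> y1 - c <= x2 ->
  `|x1 - y1| <= x2 - x1 + c *+ 3 by move=> *; rewrite ler_norml; lra.
by rewrite E'; exact: aux.
Qed.

Lemma cc_grad_quotient h i : 0 < h -> h <= 1 -> cc B (a h i).
Proof.
move=> h1 h2; have hn : `|h| <= 1 by rewrite gtr0_norm.
apply: cc_mul; last by apply: continuous_shift_fun; exact: continuous_weight.
have H : cc B (fun x => u (x + sh h i) - u x).
  by apply: ccB; [exact: cc_coord_shift|exact: cc_le radius_le cu].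
split; first by apply: continuous_funM; [apply: continuous_fun_norm; exact: H.1|exact: continuous_fun_cst].
by move=> x /H.2 ->; rewrite normr0 mul0r.
Qed.

Let Ma : R := L * de `^ (1 - s).

Lemma grad_quotient_ge0 h i x : 0 < h -> 0 <= a h i x.
Proof. by move=> h1; rewrite mulr_ge0 ?weight_ge0// divr_ge0// ltW. Qed.

Lemma grad_quotient_le h i x : 0 < h -> a h i x <= Ma.
Proof.
move=> h1; apply: ler_pM; rewrite ?weight_ge0 ?weight_le ?divr_ge0 ?(ltW h1)//.
by rewrite ler_pdivrMr// (le_trans (uL _ _ _))// gtr0_norm.
Qed.

Lemma grad_quotient_cvg i x : a (hh j) i x @[j --> \oo] --> `|G i x| * p x.
Proof.
apply: cvgM; last by apply: coord_shift_cvg; exact: continuous_weight.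
have hn j : hh j != 0 by rewrite gt_eqF//; have [] := step_bounds j.
have /cvg_norm := @uG i x _ hn step_cvg0.
have -> // : (fun j => `|(u (x + sh (hh j) i) - u x) / hh j|) =
    (fun j => `|u (x + sh (hh j) i) - u x| / hh j).
by apply/funext => j; have [hj _ _] := step_bounds j; rewrite normrM normfV (gtr0_norm hj).
Qed.

(* Translation turns [Dm] into [Dp], moving the difference onto [psi]. *)
Lemma Int_gap_cvg0 (psi : 'rV[R]_n -> R) i : cc A psi ->
  Int (fun x => psi x * Rr (hh j) i x) @[j --> \oo] --> (0 : R).
Proof.
move=> cpsi; have cpsiB := cc_le radius_le cpsi.
have [M M0 HM] := cc_bounded A0 cpsi.
have csh j : cc B (fun x => psi (x + sh (hh j) i)).
  by apply: cc_coord_shift => //; have [hj _ h1] := step_bounds j; rewrite gtr0_norm.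
have -> : (fun j => Int (fun x => psi x * Rr (hh j) i x)) = (fun j =>
    Int (fun x => (psi (x + sh (hh j) i) - psi x) * Dp (hh j) i x) +
    3 * hh j / (2 * de) * Int psi).
  apply/funext => j.
  have cDmj : cc B (fun x => psi x * Dm (hh j) i x) by exact: cc_mul (@continuous_bwd _ _).
  have cDpj : cc B (fun x => psi x * Dp (hh j) i x) by exact: cc_mul (@continuous_fwd _ _).
  have csDp : cc B (fun x => psi (x + sh (hh j) i) * Dp (hh j) i x).
    exact: cc_mul (@continuous_fwd _ _).
  rewrite -(IntZ radius_ge0)// -[RHS](IntD radius_ge0); last exact: ccZ.
  - rewrite (_ : (fun x => (psi (x + sh (hh j) i) - psi x) * Dp (hh j) i x +
      3 * hh j / (2 * de) * psi x) = (fun x => psi (x + sh (hh j) i) * Dp (hh j) i x +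
      (- (psi x * Dp (hh j) i x) + 3 * hh j / (2 * de) * psi x))); last first.
      by apply/funext => x; ring.
    have cr : cc B (fun x => - (psi x * Dp (hh j) i x) + 3 * hh j / (2 * de) * psi x).
      apply: ccD; last exact: ccZ.
      by have := ccZ (-1) cDpj; under eq_fun do rewrite mulN1r.
    rewrite (IntD radius_ge0)// (_ : Int (fun x => psi (x + sh (hh j) i) * Dp (hh j) i x) =
       Int (fun x => psi x * Dm (hh j) i x)).
      rewrite -(IntD radius_ge0)//; congr (@Int R n); apply/funext => x.
      by rewrite /Rr; ring.
    rewrite -(Int_shift radius_ge0 (sh (hh j) i) cDmj); congr (@Int R n).
    by apply/funext => x; rewrite bwd_shift.
  - apply: cc_mul; last exact: continuous_fwd.
    exact: ccB.
(* The first integral vanishes since [psi] is continuous and [|Dp| <= 1], the second since it is a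
   multiple of the step. *)
rewrite -[X in _ --> X]addr0; apply: cvgD.
  apply: (Int_cvg0 radius_ge0 (M := M *+ 2)) => [j|j x|x].
  - by apply: cc_mul; [exact: ccB|exact: continuous_fwd].
  - have [hj _ _] := step_bounds j.
    rewrite normrM (le_trans (ler_wpM2l _ (fwd_le1 i x hj)))// mulr1.
    by rewrite (le_trans (ler_normB _ _))// mulr2n lerD.
  - apply/cvgr0Pnorm_le => ep ep0.
    have /cvgrPdist_le/(_ _ ep0) := @coord_shift_cvg psi x i cpsi.1.
    apply: filterS => j; rewrite distrC => H; have [hj _ _] := step_bounds j.
    by rewrite normrM (le_trans (ler_wpM2l _ (fwd_le1 i x hj)))// mulr1.
rewrite -[X in _ --> X](mul0r (Int psi)); apply: cvgM; last exact: cvg_cst.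
rewrite -[X in _ --> X](mul0r (2 * de)^-1); apply: cvgM; last exact: cvg_cst.
rewrite -[X in _ --> X](mulr0 3); apply: cvgM; first exact: cvg_cst.
exact: step_cvg0.
Qed.

(** [Int_gap_cvg0] takes a factor independent of the step, so [a] is replaced by its pointwise
    limit; the error is absorbed by dominated convergence, as the gap is at most 4. *)
Lemma Int_grad_gap_cvg0 i : Int (fun x => a (hh j) i x * Rr (hh j) i x) @[j --> \oo] --> (0 : R).
Proof.
pose psi x := `|G i x| * p x.
have cpsi : cc A psi.
  apply: cc_mul; last exact: continuous_weight.
  split; first by apply: continuous_fun_norm; exact: (cG i).1.
  by move=> x /(cG i).2 ->; rewrite normr0.
have cpsiB := cc_le radius_le cpsi.
have [M M0 HM] := cc_bounded A0 cpsi.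
have ca j : cc B (a (hh j) i) by have [? _ ?] := step_bounds j; exact: cc_grad_quotient.
have -> : (fun j => Int (fun x => a (hh j) i x * Rr (hh j) i x)) = (fun j =>
    Int (fun x => (a (hh j) i x - psi x) * Rr (hh j) i x) + Int (fun x => psi x * Rr (hh j) i x)).
  apply/funext => j; rewrite -(IntD radius_ge0).
  - by congr (@Int R n); apply/funext => x; ring.
  - by apply: cc_mul; [exact: ccB|exact: continuous_gap].
  - by apply: cc_mul => //; exact: continuous_gap.
rewrite -[X in _ --> X]addr0; apply: cvgD; last exact: Int_gap_cvg0.
apply: (Int_cvg0 radius_ge0 (M := (Ma + M) * 4)) => [j|j x|x].
- by apply: cc_mul; [exact: ccB|exact: continuous_gap].
- have [hj hd _] := step_bounds j; rewrite normrM ler_pM ?gap_le//.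
  rewrite (le_trans (ler_normB _ _))// lerD// ger0_norm ?grad_quotient_ge0//; exact: grad_quotient_le.
- apply/cvgr0Pnorm_le => ep ep0.
  have ep4 : 0 < ep / 4 by rewrite divr_gt0.
  have /cvgrPdist_le/(_ _ ep4) := @grad_quotient_cvg i x.
  apply: filterS => j; rewrite distrC => H; have [hj hd _] := step_bounds j.
  rewrite normrM -[ep](divfK (_ : 4 != 0))//.
  by apply: ler_pM => //; exact: gap_le.
Qed.

Lemma gap_ge0 h i x : 0 < h -> de <= d x -> 0 <= Rr h i x.
Proof. by move=> h1 /(fwd_near_normal h1)[nu _ H]; rewrite (le_trans _ (H i)). Qed.

Lemma test_fun_far x : u x != 0 -> de <= d x.
Proof. by move=> /ud; move: de0; lra. Qed.

(** Nonnegativity of the gap, divided by [h]: a semiconcavity bound uniform in the step. *)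
Lemma discrete_laplacian_le h x : 0 < h -> de <= d x -> Lap h x <= n%:R * (3 / (2 * de)).
Proof.
move=> h1 dx; have -> : n%:R * (3 / (2 * de)) = \sum_(i < n) (3 / (2 * de)).
  by rewrite sumr_const card_ord mulr_natl.
apply: ler_sum => i _; rewrite ler_pdivrMr//.
have := gap_ge0 i h1 dx; rewrite /Rr.
rewrite (_ : 3 * h / (2 * de) = 3 / (2 * de) * h); last by rewrite mulrAC.
by lra.
Qed.

(* The bound on the discrete Laplacian holds only in the limit, pointwise and not
   uniformly; its excess is bounded above uniformly, so the integral still vanishes. *)
Lemma Int_excess_cvg0 : Int (F (hh j)) @[j --> \oo] --> (0 : R).
Proof.
have [M M0 HM] := cc_bounded A0 cc_weighted.
pose K := n%:R * (3 / (2 * de)) + `|lam|.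
have K0 : 0 <= K by rewrite addr_ge0// mulr_ge0// divr_ge0// mulr_ge0// ltW.
have phi0 x : u x = 0 -> phi x = 0 by rewrite /phi /w => ->; rewrite normr0 mul0r.
apply: (Int_cvg0 A0 (M := M * K)) => [j|j x|x].
- apply: cc_mul; first exact: cc_weighted.
  apply: continuous_fun_max; first exact: continuous_fun_cst.
  by apply: continuous_funD; [exact: continuous_discrete_laplacian|exact: continuous_fun_cst].
- have [ux|ux] := eqVneq (u x) 0; first by rewrite /F phi0// mul0r normr0 mulr_ge0.
  have [hj _ _] := step_bounds j; rewrite normrM ler_pM// ger0_norm ?le_max ?lexx//.
  rewrite ge_max K0 lerD ?ler_norm//; apply: discrete_laplacian_le => //; exact: test_fun_far.
have [ux|ux] := eqVneq (u x) 0.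
  by rewrite (_ : (fun j => _) = cst 0); [exact: cvg_cst|apply/funext => j; rewrite /F phi0// mul0r].
apply/cvgr0Pnorm_le => ep ep0.
(* The bound [M] on [phi] may be 0, hence the division by [M + 1]. *)
have M1 : 0 < M + 1 by lra.
have ep1 : 0 < ep / (M + 1) by rewrite divr_gt0.
have [del del0 Hdel] := dsec ux ep1.
apply: filterS (step_near_lt del0) => j hjd; have [hj _ _] := step_bounds j.
have LE : Lap (hh j) x = (\sum_i (d (x + sh (hh j) i) + d (x - sh (hh j) i) - d x *+ 2)) / hh j ^+ 2.
  rewrite mulr_suml; apply: eq_bigr => i _; rewrite /Dp /Dm; field.
  by rewrite gt_eqF.
have LB : Lap (hh j) x + lam <= ep / (M + 1).
  rewrite -lerBrDr LE ler_pdivrMr ?exprn_gt0//; exact: Hdel.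
rewrite normrM (ger0_norm (_ : 0 <= Num.max _ _)) ?le_max ?lexx//.
have -> : ep = (M + 1) * (ep / (M + 1)) by rewrite mulrC divfK// gt_eqF.
apply: ler_pM; rewrite ?le_max ?lexx//; first by rewrite (le_trans (HM x))// lerDl.
by rewrite ge_max LB ltW.
Qed.

Lemma Int_grad_cvg : Int (Nn (hh j)) @[j --> \oo] -->
  Int (fun x => Num.sqrt (\sum_i G i x ^+ 2) * p x).
Proof.
have ca j i : cc B (a (hh j) i) by have [? _ ?] := step_bounds j; exact: cc_grad_quotient.
apply: (Int_dominated radius_ge0 (M := Num.sqrt n%:R * `|Ma|)) => [j||j x|x].
- split; first apply: continuous_fun_sqrt.
    by apply: continuous_fun_sum => i; apply: continuous_funM; exact: (ca j i).1.
  move=> x Bx; rewrite /Nn big1 ?sqrtr0// => i _.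
  by rewrite (ca j i).2// expr0n.
- apply: cc_mul; last exact: continuous_weight.
  split; first apply: continuous_fun_sqrt.
    by apply: continuous_fun_sum => i; apply: continuous_funM; exact: (cG i).1.
  move=> x Bx; rewrite big1 ?sqrtr0// => i _.
  by rewrite (cc_le radius_le (cG i)).2// expr0n.
- have [hj _ _] := step_bounds j.
  rewrite ger0_norm ?sqrtr_ge0//.
  have -> : Nn (hh j) x = enorm (\row_i a (hh j) i x).
    by congr Num.sqrt; apply: eq_bigr => i _; rewrite mxE.
  rewrite (le_trans (enorm_le_norm _))// ler_wpM2l ?sqrtr_ge0//.
  apply: rV_norm_le => // i; rewrite mxE ger0_norm ?grad_quotient_ge0//.
  by rewrite (le_trans (grad_quotient_le _ _ hj))// ler_norm.
have -> : Num.sqrt (\sum_i G i x ^+ 2) * p x = Num.sqrt (\sum_i (`|G i x| * p x) ^+ 2).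
  rewrite -[p x in LHS]ger0_norm ?weight_ge0// -sqrtr_sqr -sqrtrM; last first.
    by apply: sumr_ge0 => i _; exact: sqr_ge0.
  congr Num.sqrt; rewrite mulr_suml; apply: eq_bigr => i _.
  by rewrite exprMn real_normK ?num_real.
have H : (\sum_i a (hh j) i x ^+ 2) @[j --> \oo] --> \sum_i (`|G i x| * p x) ^+ 2.
  apply: cvg_big => [|i _]; first exact: add_continuous.
  by rewrite expr2; under eq_fun do rewrite expr2; apply: cvgM; exact: grad_quotient_cvg.
exact: (cvg_comp _ _ H (@sqrt_continuous R _)).
Qed.

Lemma Int_potential_cvg : Int (W (hh j)) @[j --> \oo] --> Int (fun x => w x * e x `^ (- s)).
Proof.
have [M M0 HM] := cc_bounded A0 cc_abs.
have s0 : 0 <= s by rewrite (le_trans ler01).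
apply: (Int_dominated A0 (M := M * de `^ (- s))) => [j||j x|x].
- have [hj _ _] := step_bounds j; apply: cc_mul; first exact: cc_abs.
  apply: continuous_fun_powR => [|t].
    by apply: continuous_funD; [exact: continuous_trunc_dist|exact: continuous_fun_cst].
  by rewrite addr_gt0 ?trunc_dist_gt0.
- by apply: cc_mul; [exact: cc_abs|apply: continuous_fun_powR; [exact: continuous_trunc_dist|exact: trunc_dist_gt0]].
- have [hj _ _] := step_bounds j; rewrite normrM ler_pM//.
  rewrite ger0_norm ?powR_ge0// powR_anti//.
  by rewrite (le_trans (trunc_dist_ge x))// lerDl ltW.
apply: cvgM; first exact: cvg_cst.
have c1 : {for e x, continuous (@powR R ^~ (- s))}.
  apply: differentiable_continuous; apply/derivable1_diffP.
  by case: (is_derive1_powR (- s) (trunc_dist_gt0 x)).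
have H : e x + hh j @[j --> \oo] --> e x.
  by rewrite -[X in _ --> X]addr0; apply: cvgD; [exact: cvg_cst|exact: step_cvg0].
exact: (cvg_comp _ _ H c1).
Qed.

(** The discrete counterpart of one summand of the product of the gradients of [phi] and [d]. *)
Let Bd h i x := (phi (x + sh h i) - phi x) / h * Dp h i x.

Lemma cc_flux h i : 0 < h -> h <= 1 -> cc B (Bd h i).
Proof.
move=> h1 h2; have hn : `|h| <= 1 by rewrite gtr0_norm.
apply: cc_mul; last exact: continuous_fwd.
have H : cc B (fun x => phi (x + sh h i) - phi x).
  by apply: ccB; [exact: cc_coord_shift cc_weighted hn|exact: cc_le radius_le cc_weighted].
split; first by apply: continuous_funM; [exact: H.1|exact: continuous_fun_cst].
by move=> x /H.2 ->; rewrite mul0r.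
Qed.

(** Summation by parts: translating [phi * Dm] by one step turns it into the shifted [phi] times
    [Dp]. *)
Lemma Int_flux h : 0 < h -> h <= 1 ->
  Int (fun x => \sum_i Bd h i x) = Int (fun x => - (phi x * Lap h x)).
Proof.
move=> h1 h2; have hn : `|h| <= 1 by rewrite gtr0_norm.
have cphiB := cc_le radius_le cc_weighted.
rewrite (Int_sum radius_ge0); last by move=> i; exact: cc_flux.
have -> : (fun x => - (phi x * Lap h x)) =
    (fun x => \sum_i h^-1 * (phi x * Dm h i x - phi x * Dp h i x)).
  by apply/funext => x; rewrite mulr_sumr -sumrN; apply: eq_bigr => i _; field; rewrite gt_eqF.
have c1 i : cc B (fun x => phi x * Dm h i x) by exact: cc_mul (@continuous_bwd _ _).
have c2 i : cc B (fun x => phi x * Dp h i x) by exact: cc_mul (@continuous_fwd _ _).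
have c3 i : cc B (fun x => phi (x + sh h i) * Dp h i x).
  by apply: cc_mul; [exact: cc_coord_shift cc_weighted hn|exact: continuous_fwd].
rewrite (Int_sum radius_ge0); last by move=> i; apply: ccZ; exact: ccB.
apply: eq_bigr => i _; rewrite (IntZ radius_ge0); last exact: ccB.
rewrite (IntB radius_ge0)// -(Int_shift radius_ge0 (sh h i) (c1 i)).
have -> : (fun x => phi (x + sh h i) * Dm h i (x + sh h i)) =
   (fun x => phi (x + sh h i) * Dp h i x) by apply/funext => x; rewrite bwd_shift.
rewrite -(IntB radius_ge0)// -(IntZ radius_ge0); last exact: ccB.
by congr (@Int R n); apply/funext => x; rewrite /Bd; ring.
Qed.

(** The 2 comes from [|Dp + nu| <= 2], the rest from bounding [(s - 1) (d x + h)^(-s)] uniformly. *)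
Let cst2 : R := 2 * (s - 1) * de `^ (- s).

(** Write [Dp = nu + (Dp - nu)]. Cauchy-Schwarz with the unit vector [nu] leaves [Nn], and the
    remainder is bounded by the gap; the reverse triangle inequality passes from [|u|] to [u]. *)
Lemma flux_grad_part h x (nu : 'I_n -> R) : 0 < h -> \sum_i nu i ^+ 2 = 1 ->
  (forall i, `|Dp h i x - nu i| <= Rr h i x) ->
  \sum_i (w (x + sh h i) - w x) / h * p (x + sh h i) * Dp h i x <=
  Nn h x + \sum_i a h i x * Rr h i x.
Proof.
move=> h1 nu1 Hnu.
pose b i := (w (x + sh h i) - w x) / h * p (x + sh h i).
have ba i : `|b i| <= a h i x.
  rewrite normrM (ger0_norm (weight_ge0 _)) ler_wpM2r ?weight_ge0//.
  rewrite normrM normfV (gtr0_norm h1) ler_wpM2r ?invr_ge0 ?(ltW h1)//.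
  exact: ler_dist_dist.
have -> : \sum_i (w (x + sh h i) - w x) / h * p (x + sh h i) * Dp h i x =
    \sum_i b i * nu i + \sum_i b i * (Dp h i x - nu i).
  by rewrite -big_split/=; apply: eq_bigr => i _; rewrite /b; ring.
apply: lerD.
  apply: (le_trans (cauchy_schwarz b nu)); rewrite nu1 sqrtr1 mulr1.
  rewrite ler_sqrt; last by apply: sumr_ge0 => i _; exact: sqr_ge0.
  apply: ler_sum => i _; rewrite -[b i ^+ 2]real_normK ?num_real//.
  exact: ler_sqr_ge0.
apply: ler_sum => i _; apply: (le_trans (ler_norm _)).
by rewrite normrM ler_pM.
Qed.

Lemma flux_weight_part h x (nu : 'I_n -> R) : 0 < h -> h <= de -> u x != 0 ->
  \sum_i nu i ^+ 2 = 1 -> (forall i, `|Dp h i x - nu i| <= Rr h i x) ->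
  \sum_i w x * ((p (x + sh h i) - p x) / h) * Dp h i x <=
  - ((s - 1) * W h x) + cst2 * \sum_i w x * Rr h i x.
Proof.
move=> h1 hd ux nu1 Hnu; have dx := ud ux.
have ddx : de <= d x := test_fun_far ux.
have ex : e x = d x by apply: max_l.
have s10 : 0 <= s - 1 by rewrite subr_ge0.
have dxh i : de <= d (x + sh h i).
  have := dlip x (sh h i); rewrite enorm_coord_shift (gtr0_norm h1) ler_norml => /andP[H _].
  by move: H dx hd; rewrite mulr2n; lra.
have nule i : `|nu i| <= 1.
  rewrite -[leRHS]sqrtr1 -sqrtr_sqr ler_sqrt// -nu1 (bigD1 i)//= lerDl.
  by apply: sumr_ge0 => k _; exact: sqr_ge0.
pose Z := (d x + h) `^ (- s).
have Z0 : 0 <= Z by exact: powR_ge0.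
have Zde : Z <= de `^ (- s).
  by apply: powR_anti => //; [rewrite (le_trans ler01)|lra].
have Rge i : 0 <= Rr h i x by exact: gap_ge0.
have step i : (p (x + sh h i) - p x) / h * Dp h i x <= - ((s - 1) * Z * Dp h i x ^+ 2).
  have exh : e (x + sh h i) = d (x + sh h i) by apply: max_l.
  have -> : (p (x + sh h i) - p x) / h * Dp h i x =
      (p (x + sh h i) - p x) * (d (x + sh h i) - d x) / h ^+ 2.
    by rewrite /Dp; field; rewrite gt_eqF.
  rewrite ler_pdivrMr ?exprn_gt0// /p exh ex.
  have -> : - ((s - 1) * Z * Dp h i x ^+ 2) * h ^+ 2 =
    - ((s - 1) * (d x + h) `^ (- s) * (d (x + sh h i) - d x) ^+ 2).
    by rewrite /Dp -/Z; field; rewrite gt_eqF.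
  apply: powR_slope => //; [exact: lt_le_trans ddx|exact: lt_le_trans (dxh i)|].
  by rewrite (le_trans (dlip _ _))// enorm_coord_shift gtr0_norm.
(* The discrete substitute for [|grad d| = 1], obtained by factoring [nu^2 - Dp^2] in each
   coordinate. *)
have D2 : 1 - 2 * \sum_i Rr h i x <= \sum_i Dp h i x ^+ 2.
  rewrite -[X in X - _]nu1 mulr_sumr -sumrB; apply: ler_sum => i _.
  have H1 : `|Dp h i x + nu i| <= 2.
    rewrite (le_trans (ler_normD _ _))//; have := nule i; have := fwd_le1 i x h1; lra.
  have H2 : nu i ^+ 2 - Dp h i x ^+ 2 <= 2 * Rr h i x.
    have -> : nu i ^+ 2 - Dp h i x ^+ 2 = - ((Dp h i x + nu i) * (Dp h i x - nu i)) by ring.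
    by rewrite (le_trans (ler_norm _))// normrN normrM ler_pM.
  by move: H2; lra.
have w0 : 0 <= w x by exact: normr_ge0.
apply: (@le_trans _ _ (w x * (- ((s - 1) * Z * (1 - 2 * \sum_i Rr h i x))))).
  have -> : \sum_i w x * ((p (x + sh h i) - p x) / h) * Dp h i x =
      w x * \sum_i (p (x + sh h i) - p x) / h * Dp h i x.
    by rewrite mulr_sumr; apply: eq_bigr => i _; ring.
  apply: ler_wpM2l => //; apply: (le_trans (ler_sum _ (fun i _ => step i))).
  by rewrite sumrN -mulr_sumr lerN2 ler_wpM2l// mulr_ge0.
rewrite /W ex -/Z -mulr_sumr.
have -> : w x * (- ((s - 1) * Z * (1 - 2 * \sum_i Rr h i x))) =
  - ((s - 1) * (w x * Z)) + 2 * (s - 1) * Z * (w x * \sum_i Rr h i x) by ring.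
rewrite lerD2l; apply: ler_wpM2r; first by rewrite mulr_ge0// sumr_ge0.
by apply: ler_wpM2l => //; rewrite mulr_ge0.
Qed.

Lemma flux_pointwise h x : 0 < h -> h <= de ->
  \sum_i Bd h i x <= Nn h x + \sum_i a h i x * Rr h i x +
    (- ((s - 1) * W h x) + cst2 * \sum_i w x * Rr h i x).
Proof.
move=> h1 hd.
have -> : \sum_i Bd h i x =
   \sum_i (w (x + sh h i) - w x) / h * p (x + sh h i) * Dp h i x +
   \sum_i w x * ((p (x + sh h i) - p x) / h) * Dp h i x.
  by rewrite -big_split/=; apply: eq_bigr => i _; rewrite /Bd /phi; ring.
have [dx|dx] := leP de (d x).
  have [nu nu1 Hnu] := fwd_near_normal h1 dx.
  apply: lerD; first exact: flux_grad_part nu1 Hnu.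
  have [ux|ux] := eqVneq (u x) 0; last exact: flux_weight_part nu1 Hnu.
  have wx : w x = 0 by rewrite /w ux normr0.
  rewrite /W wx mul0r mulr0 oppr0 add0r !big1 ?mulr0// => i _; by rewrite !mul0r.
(* Where [d x < de], the margin in [ud] makes [u] vanish at [x] and at all points one step away, so
   both sides are 0. *)
have u0 : u x = 0.
  by apply: contraTeq dx => /test_fun_far; rewrite leNgt.
have uh i : u (x + sh h i) = 0.
  apply: contraTeq dx => /ud H; rewrite -leNgt.
  have := dlip x (sh h i); rewrite enorm_coord_shift (gtr0_norm h1) ler_norml => /andP[_].
  by move: H hd; rewrite mulr2n; lra.
have wx : w x = 0 by rewrite /w u0 normr0.
have wxh i : w (x + sh h i) = 0 by rewrite /w uh normr0.
have ax i : a h i x = 0 by rewrite /a uh u0 subrr normr0 !mul0r.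
have z0 : \sum_i (w (x + sh h i) - w x) / h * p (x + sh h i) * Dp h i x = 0.
  by apply: big1 => i _; rewrite wxh wx subrr !mul0r.
have z1 : \sum_i w x * ((p (x + sh h i) - p x) / h) * Dp h i x = 0.
  by apply: big1 => i _; rewrite wx !mul0r.
have z2 : \sum_i a h i x * Rr h i x = 0 by apply: big1 => i _; rewrite ax mul0r.
have z3 : \sum_i w x * Rr h i x = 0 by apply: big1 => i _; rewrite wx mul0r.
have z4 : \sum_i a h i x ^+ 2 = 0 by apply: big1 => i _; rewrite ax expr0n.
by rewrite z0 z1 z2 z3 /Nn z4 sqrtr0 /W wx mul0r !mulr0 oppr0 !addr0.
Qed.

(** For each step, [LHS j <= - Int (phi * Lap) = Int (sum of Bd) <= RHS j]; only the two ends are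
    taken to the limit, as the middle terms need not converge. *)
Theorem weighted_gradient_inequality :
  lam * Int phi <= Int (fun x => Num.sqrt (\sum_i G i x ^+ 2) * p x)
    - (s - 1) * Int (fun x => w x * e x `^ (- s)).
Proof.
pose LHS j := lam * Int phi - Int (F (hh j)).
pose RHS j := Int (Nn (hh j)) + \sum_i Int (fun x => a (hh j) i x * Rr (hh j) i x) +
    (- ((s - 1) * Int (W (hh j))) + cst2 * \sum_i Int (fun x => w x * Rr (hh j) i x)).
have lL : LHS j @[j --> \oo] --> lam * Int phi.
  by rewrite -[X in _ --> X]subr0; apply: cvgB; [exact: cvg_cst|exact: Int_excess_cvg0].
have z0 : \sum_(i < n) (0 : R) = 0 by rewrite big1.
have lR : RHS j @[j --> \oo] --> Int (fun x => Num.sqrt (\sum_i G i x ^+ 2) * p x)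
    - (s - 1) * Int (fun x => w x * e x `^ (- s)).
  rewrite -[X in _ --> X]addr0 -addrA -[X in _ --> X + _]addr0; apply: cvgD.
    apply: cvgD; first exact: Int_grad_cvg.
    rewrite -[X in _ --> X]z0.
    by apply: cvg_big => [|i _]; [exact: add_continuous|exact: Int_grad_gap_cvg0].
  apply: cvgD; first by apply: cvgN; apply: cvgM; [exact: cvg_cst|exact: Int_potential_cvg].
  rewrite -[X in _ --> X](mulr0 cst2); apply: cvgM; first exact: cvg_cst.
  rewrite -[X in _ --> X]z0.
  by apply: cvg_big => [|i _]; [exact: add_continuous|exact: Int_gap_cvg0 cc_abs].
apply: (ler_cvg_to lL lR); apply: nearW => j.
have [hj hd h1] := step_bounds j.
have ca i : cc B (a (hh j) i) by exact: cc_grad_quotient.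
have cF : cc A (F (hh j)).
  apply: cc_mul; first exact: cc_weighted.
  apply: continuous_fun_max; first exact: continuous_fun_cst.
  by apply: continuous_funD; [exact: continuous_discrete_laplacian|exact: continuous_fun_cst].
have cW : cc A (W (hh j)).
  apply: cc_mul; first exact: cc_abs.
  apply: continuous_fun_powR => [|t].
    by apply: continuous_funD; [exact: continuous_trunc_dist|exact: continuous_fun_cst].
  by rewrite addr_gt0 ?trunc_dist_gt0.
have cN : cc B (Nn (hh j)).
  split; first apply: continuous_fun_sqrt.
    by apply: continuous_fun_sum => i; apply: continuous_funM; exact: (ca i).1.
  move=> x Bx; rewrite /Nn big1 ?sqrtr0// => i _.
  by rewrite (ca i).2// expr0n.
have caR i : cc B (fun x => a (hh j) i x * Rr (hh j) i x) by apply: cc_mul => //; exact: continuous_gap.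
have cwR i : cc B (fun x => w x * Rr (hh j) i x).
  by apply: cc_mul; [exact: cc_le radius_le cc_abs|exact: continuous_gap].
apply: (@le_trans _ _ (Int (fun x => \sum_i Bd (hh j) i x))).
  rewrite Int_flux// /LHS -(IntZ A0 lam cc_weighted) -(IntB A0)//; last exact: ccZ cc_weighted.
  apply: (le_Int A0).
  - by apply: ccB => //; exact: ccZ cc_weighted.
  - have := ccZ (-1) (cc_mul cc_weighted (@continuous_discrete_laplacian (hh j))).
    by under eq_fun do rewrite mulN1r.
  move=> x; rewrite /F.
  have phiG : 0 <= phi x := mulr_ge0 (normr_ge0 _) (weight_ge0 x).
  have : Lap (hh j) x + lam <= Num.max 0 (Lap (hh j) x + lam) by rewrite le_max lexx orbT.
  move=> /(ler_wpM2l phiG); lra.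
have -> : RHS j = Int (fun x => Nn (hh j) x + \sum_i a (hh j) i x * Rr (hh j) i x +
    (- (s - 1) * W (hh j) x + cst2 * \sum_i w x * Rr (hh j) i x)).
  rewrite (IntD radius_ge0).
  - rewrite (IntD radius_ge0)//; last exact: cc_sum.
    rewrite (IntD radius_ge0); last by apply: ccZ; exact: cc_sum.
      rewrite (IntZ A0 _ cW) (IntZ radius_ge0 cst2 (cc_sum cwR)).
      by rewrite !(Int_sum radius_ge0)// mulNr.
    by apply: ccZ; exact: cc_le radius_le cW.
  - by apply: ccD => //; exact: cc_sum.
  - apply: ccD; first by apply: ccZ; exact: cc_le radius_le cW.
    by apply: ccZ; exact: cc_sum.
apply: (le_Int radius_ge0).
- by apply: cc_sum => i; exact: cc_flux.
- apply: ccD; first by apply: ccD => //; exact: cc_sum.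
  apply: ccD; first by apply: ccZ; exact: cc_le radius_le cW.
  by apply: ccZ; exact: cc_sum.
by move=> x; rewrite mulNr; exact: flux_pointwise.
Qed.

End MainInequality.

(** * Test functions *)

Section TestFunctions.
Variables (R : realType) (n : nat) (u : 'rV[R]_n -> R).
Hypothesis Cu : Cinf u.
Local Notation K := (closure [set x | u x != 0]).

Lemma Cinf_differentiable x : differentiable u x.
Proof. exact: (Cu 1).1. Qed.

Lemma Cinf_continuous : continuous u.
Proof. by move=> x; apply: differentiable_continuous; exact: Cinf_differentiable. Qed.

Lemma Cinf_partial_continuous i : continuous (partial i u).
Proof. exact: (Cu 1).2. Qed.

Lemma supp_out x : ~ K x -> u x = 0.
Proof.
by move=> xK; apply/eqP; apply: contrapT => /negP ux; apply: xK; exact: subset_closure.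
Qed.

Lemma supp_out_partial i x : ~ K x -> partial i u x = 0.
Proof.
move=> xK; rewrite /partial (@near_eq_derive _ _ _ u (cst 0) x) ?derive_cst//.
have oK : open (~` K) by apply: closed_openC; exact: closed_closure.
have : \forall y \near x, (~` K) y by apply: open_nbhs_nbhs; split.
by apply: filterS => y /supp_out.
Qed.

Lemma supp_cc : compact K -> exists A : R, [/\ 0 <= A, cc A u & forall i, cc A (partial i u)].
Proof.
move=> /compact_bounded [M [_ HM]].
have H x : `|M| + 1 < `|x| -> ~ K x.
  move=> Mx xK; have : M < `|M| + 1 by rewrite (le_lt_trans (ler_norm M))// ltrDl.
  by move=> H; have := HM _ H x xK; rewrite /= leNgt Mx.
exists (`|M| + 1); split => [||i]; first by rewrite addr_ge0.
  by split; [exact: Cinf_continuous|move=> x /H/supp_out].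
split; first exact: Cinf_partial_continuous.
by move=> x /H; exact: supp_out_partial.
Qed.

Lemma Cinf_diff_quotient i x (h : nat -> R) : (forall j, h j != 0) ->
  h j @[j --> \oo] --> (0 : R) ->
  (u (x + h j *: delta_mx 0 i) - u x) / h j @[j --> \oo] --> partial i u x.
Proof.
move=> hn0 h0.
have dux : derivable u x (delta_mx 0 i) by apply: diff_derivable; exact: Cinf_differentiable.
have /cvgr_dnbhsP/(_ h (conj hn0 h0)) := dux.
rewrite -[lim _]/(derive u x (delta_mx 0 i)) -/(partial i u x).
have -> : (fun j => (u (x + h j *: delta_mx 0 i) - u x) / h j) =
    (fun j => (h j)^-1 *: ((u \o shift x) (h j *: delta_mx 0 i) - u x)).
  by apply/funext => j; rewrite /= /GRing.scale /= mulrC [x + _]addrC.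
by [].
Qed.

Lemma Cinf_mvt i x (h : R) : 0 < h -> exists y,
  u (x + h *: delta_mx 0 i) - u x = partial i u y * h.
Proof.
move=> h0.
have dl (k : R) : is_derive k 1 (fun k : R => u (x + k *: delta_mx 0 i))
    (partial i u (x + k *: delta_mx 0 i)).
  by apply: is_derive_line; exact: Cinf_differentiable.
have cl : {within `[0, h], continuous (fun k : R => u (x + k *: delta_mx 0 i))}.
  by apply: continuous_subspaceT; apply: continuous_line; exact: Cinf_continuous.
have [c _ E] := MVT h0 (fun k _ => dl k) cl.
by exists (x + c *: delta_mx 0 i); move: E; rewrite scale0r addr0 subr0.
Qed.

Lemma Cinf_lipschitz : compact K ->
  exists L : R, forall i x h, `|u (x + h *: delta_mx 0 i) - u x| <= L * `|h|.
Proof.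
move=> /supp_cc[A [A0 _ cG]].
have /choice[M HM] i : exists M, 0 <= M /\ forall x, `|partial i u x| <= M.
  by have [M M0 HM] := cc_bounded A0 (cG i); exists M.
(* Summing the bounds gives one constant for all directions. *)
exists (\sum_i M i) => i.
have Mi : M i <= \sum_i M i.
  by rewrite (bigD1 i)//= lerDl sumr_ge0// => k _; exact: (HM k).1.
have pos x h : 0 < h -> `|u (x + h *: delta_mx 0 i) - u x| <= (\sum_i M i) * `|h|.
  move=> h0; have [y ->] := Cinf_mvt i x h0.
  by rewrite normrM ler_wpM2r// (le_trans ((HM i).2 y)).
move=> x h; have [h0|h0|->] := ltgtP h 0; last by rewrite scale0r addr0 subrr normr0 mulr0.
  have h1 : 0 < - h by rewrite oppr_gt0.
  by have := pos (x + h *: delta_mx 0 i) _ h1; rewrite scaleNr addrK distrC normrN.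
exact: pos.
Qed.

End TestFunctions.

(** * Conclusion *)

Section Domain.
Variables (R : realType) (m : nat).
Local Notation n := m.+1.
Variables (Om : set 'rV[R]_n) (s lam : R) (u : 'rV[R]_n -> R).
Hypotheses (oOm : open Om) (Om0 : ~` Om !=set0) (C2 : C2_boundary Om) (s1 : 1 <= s).
Hypothesis lamH : forall y Q rho g, bdry Om y -> @bdry_chart R n Om y Q rho g ->
  lam <= \sum_j partial j (partial j g) 0.
Hypothesis tu : test_fun Om u.
Local Notation d := (dist_compl Om).
Local Notation K := (closure [set x | u x != 0]).

Lemma test_fun_dist : exists2 de : R, 0 < de & forall x, K x -> de *+ 2 <= d x.
Proof.
have [_ cK KO [x0 ux0]] := tu.
have K0 : K !=set0 by exists x0; exact: subset_closure.
have [x + xmin] := compact_EVT_min K0 cK (continuous_subspaceT (continuous_dist Om0)).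
rewrite inE => xK; exists (d x / 2).
  by rewrite divr_gt0// dist_gt0//; exact: KO.
move=> y yK; have -> : (d x / 2) *+ 2 = d x by rewrite mulr2n -splitr.
apply: xmin.
by rewrite inE.
Qed.

Lemma dist_sec x e : Om x -> 0 < e -> exists2 del : R, 0 < del & forall h, 0 < h < del ->
  \sum_i (d (x + h *: delta_mx 0 i) + d (x - h *: delta_mx 0 i) - d x *+ 2) <=
  (e - lam) * h ^+ 2.
Proof.
move=> xO e0; have [y yO xy] := dist_attained oOm Om0 x.
have yb := nearest_bdry oOm Om0 xO yO xy.
have [Q [rho [g ch]]] := C2 yb.
have [del del0 H] := dist_second_diff oOm Om0 xO xy ch e0.
exists del => // h hd; rewrite (le_trans (H h hd))// ler_wpM2r ?sqr_ge0// lerD2l lerN2.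
exact: lamH ch.
Qed.

Lemma B1_quotient_ge : lam <= B1_quotient Om s u.
Proof.
have [Cu cK KO [x0 ux0]] := tu.
have [de de0 Kde] := test_fun_dist.
have [A [A0 cu cG]] := supp_cc Cu cK.
have [L HL] := Cinf_lipschitz Cu cK.
have dnu x : de <= d x -> exists2 nu : 'rV[R]_n, \sum_i nu 0 i ^+ 2 = 1 &
    forall v, d (x + v) <= d x + \sum_i nu 0 i * v 0 i + enorm v ^+ 2 / (2 * de).
  move=> dx; have d0 : 0 < d x := lt_le_trans de0 dx.
  have xO : Om x by apply: (dist_ball (x := x)); rewrite subrr enorm0.
  have [nu nu1 H] := dist_superdiff oOm Om0 xO; exists nu => // v.
  rewrite (le_trans (H v))// lerD2l ler_wpM2l ?sqr_ge0// lef_pV2 ?posrE ?mulr_gt0//.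
  by rewrite ler_pM2l.
have uK x : u x != 0 -> K x by move=> ux; exact: subset_closure.
have dsec x : u x != 0 -> forall e : R, 0 < e -> _ :=
  fun ux e e0 => dist_sec (KO x (uK x ux)) e0.
have ud x : u x != 0 -> de *+ 2 <= d x by move=> /uK/Kde.
have main := weighted_gradient_inequality A0 de0 s1 (dist_shift_norm Om0)
  (continuous_dist Om0) dnu dsec cu cG (Cinf_diff_quotient Cu) HL ud.
pose e x := Num.max (d x) de.
have e0 x : 0 < e x by rewrite lt_max de0 orbT.
have ce : continuous e.
  by apply: continuous_fun_max; [exact: continuous_dist|exact: continuous_fun_cst].
have cw : cc A (fun x => `|u x|).
  split; first by apply: continuous_fun_norm; exact: cu.1.
  by move=> x /cu.2 ->; rewrite normr0.
(* On [K] the truncation is inactive and the indicator is 1; off [K] both sides vanish with [f].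
   This replaces a weight that may be singular at the boundary by a continuous one. *)
have onK (f : 'rV[R]_n -> R) r x : (~ K x -> f x = 0) ->
    \1_Om x * (f x * d x `^ r) = f x * e x `^ r.
  move=> f0; have [xK|xK] := pselect (K x); last by rewrite f0// !mul0r mulr0.
  have -> : e x = d x by apply: max_l; have := Kde x xK; lra.
  by rewrite indicE mem_set ?mul1r//; exact: KO.
have conv (f : 'rV[R]_n -> R) r : cc A f -> (forall x, ~ K x -> f x = 0) ->
    fine (integral_on Om (fun x => f x * d x `^ r)) = Int (fun x => f x * e x `^ r).
  move=> cf f0; rewrite /integral_on /Int; congr (fine (iint _)); apply/funext => x /=.
  by rewrite onK//; exact: f0.
have w0 x : ~ K x -> `|u x| = 0 by move=> /supp_out ->; rewrite normr0.
have cg : cc A (grad_norm u).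
  split; first apply: continuous_fun_sqrt.
    by apply: continuous_fun_sum => i; apply: continuous_funM; exact: (cG i).1.
  by move=> x xA; rewrite /grad_norm big1 ?sqrtr0// => i _; rewrite (cG i).2// expr0n.
have g0 x : ~ K x -> grad_norm u x = 0.
  by move=> xK; rewrite /grad_norm big1 ?sqrtr0// => i _; rewrite supp_out_partial// expr0n.
rewrite /B1_quotient (conv _ _ cg g0) !(conv _ _ cw w0).
rewrite ler_pdivlMr; first exact: main.
apply: (Int_gt0 A0 (x0 := x0)).
- by apply: cc_mul => //; exact: continuous_fun_powR.
- by move=> x; rewrite mulr_ge0 ?powR_ge0.
- by rewrite mulr_gt0 ?powR_gt0 ?normr_gt0.
Qed.

End Domain.

Unset Implicit Arguments.

Theorem theorem4p2 (R : realType) (n : nat) (Om : set 'rV[R]_n) (s : R) :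
  (2 <= n)%N ->
  open Om -> connected Om -> Om !=set0 -> ~` Om !=set0 ->
  C2_boundary Om -> interior_sphere Om ->
  1 <= s ->
  ((n.-1)%:R%:E * Hinf Om <= B1 Om s)%E.
Proof.
case: n Om => [|[|k]]// Om _ oOm _ _ Om0 C2 _ s1.
pose m := k.+1; have m0 : 0 < m%:R :> R by rewrite ltr0n.
apply: le_ereal_inf_tmp => _ [u tu <-].
have [_ _ KO [x0 ux0]] := tu.
have x0O : Om x0 by apply: KO; exact: subset_closure.
(* A chart at a boundary point nearest to [x0] rules out [Hinf Om = +oo], the infimum of an empty
   set. *)
have [y yO xy] := dist_attained oOm Om0 x0.
have yb := nearest_bdry oOm Om0 x0O yO xy.
have [Q [rho [g ch]]] := C2 y yb.
have Hle g' : (exists y Q rho, bdry Om y /\ bdry_chart Om y Q rho g') ->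
    (Hinf Om <= (mean_curv_chart g')%:E)%E.
  by move=> H; apply: ereal_inf_lbound; exists g'.
have Hg := Hle g (ex_intro _ y (ex_intro _ Q (ex_intro _ rho (conj yb ch)))).
case HE : (Hinf Om) Hle Hg => [r| |] Hle Hg.
- rewrite -EFinM lee_fin; apply: B1_quotient_ge => // y' Q' rho' g' yb' ch'.
  have : (r%:E <= (mean_curv_chart g')%:E)%E by apply: Hle; exists y', Q', rho'.
  by rewrite lee_fin /mean_curv_chart ler_pdivlMr// mulrC.
- by move: Hg; rewrite leye_eq.
(* Positivity of [n - 1] matters here: the product of 0 and [-oo] is 0. *)
- by rewrite gt0_muleNy ?lte_fin// leNye.
Qed.
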